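(* Let $a<0$ and $\mu=\frac{1}{1-a}\in(0,1)$. Define $$\bar\Omega_a(X)=-\sin(\pi\mu)\,\frac{\mathbf 1_{\{X>1\}}}{|1-X|^{\mu}},\qquad \bar c_{l,a}=1-a,\qquad \bar c_{\omega,a}=-1.$$ Then $\mathcal H(\bar\Omega_a)(X)=\frac{\mathbf 1_{\{X<1\}}+\mathbf 1_{\{X>1\}}\cos(\pi\mu)}{|1-X|^{\mu}}$, and with $\bar U_a(X)=\int_0^X\mathcal H(\bar\Omega_a)(Y)\,dY$, the triple $(\bar\Omega_a,\bar c_{l,a},\bar c_{\omega,a})$ solves the self-similar profile equation $$(\bar c_{l,a}X+a\bar U_a)\,(\bar\Omega_a)_X=(\bar c_{\omega,a}+(\bar U_a)_X)\,\bar\Omega_a$$ at every $X\ne1$.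
   Context: $\mathcal H$ denotes the Hilbert transform on $\mathbb R$: $\mathcal H(f)(x)=\frac1\pi\,\mathrm{P.V.}\int_{\mathbb R}\frac{f(y)}{x-y}\,dy$. $\mathbf 1_{A}$ is the indicator of the set $A$. *)

(* Defs.v *)
From HB Require Import structures.
From mathcomp Require Import all_boot all_order all_algebra.
From mathcomp Require Import all_classical all_reals all_analysis.
Set Implicit Arguments. Unset Strict Implicit. Unset Printing Implicit Defensive.
Import Order.TTheory GRing.Theory Num.Theory.
Import numFieldNormedType.Exports.
Local Open Scope classical_set_scope.
Local Open Scope ring_scope.

Definition hilbert_trunc (R : realType) (f : R -> R) (x eps : R) : R :=
  pi^-1 * Rintegral lebesgue_measure [set y : R | eps < `|x - y|]
                    (fun y => f y / (x - y)).

Definition is_hilbert (R : realType) (f : R -> R) (x v : R) : Prop :=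
  (forall eps : R, 0 < eps ->
     lebesgue_measure.-integrable [set y : R | eps < `|x - y|]
       (fun y => (f y / (x - y))%:E)) /\
  hilbert_trunc f x eps @[eps --> 0^'+] --> v.

Definition hilbert (R : realType) (f : R -> R) (x : R) : R :=
  lim (hilbert_trunc f x eps @[eps --> 0^'+]).

Definition oint (R : realType) (g : R -> R) (a b : R) : R :=
  if a <= b then Rintegral lebesgue_measure `[a, b] g
  else - Rintegral lebesgue_measure `[b, a] g.

Definition Omega_bar (R : realType) (a : R) (X : R) : R :=
  let mu := (1 - a)^-1 in
  - sin (pi * mu) * ((if 1 < X then 1 else 0) / (`|1 - X| `^ mu)).

Definition U_bar (R : realType) (a : R) (X : R) : R :=
  oint (hilbert (Omega_bar a)) 0 X.

(* Main.v *)
(* The function [ibeta a], a primitive of t^(a-1)/(1-t) on ]0, 1[ vanishing at 0,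
   yields after an affine or inverse change of variable primitives of both sides of
   the truncated Hilbert integral, so that the transform reduces to the constants
   [ibeta_cst a] = lim_(x -> 1-) (ibeta a x + ln (1 - x)).  For X > 1 one needs
   ibeta_cst mu - ibeta_cst (1 - mu) = pi cot (pi mu): both sides satisfy
   2 h(x) = h(x/2) + h((x+1)/2), and their difference is Lipschitz on ]0, 1[, hence
   constant, hence zero by antisymmetry about 1/2.  For X < 1, writing
   1/(1+t) = 2/(1-t^2) - 1/(1-t) reduces the integral of t^(-mu)/(1+t) to the same
   constants and to pi / sin (pi mu).  U_bar is then explicit by the fundamental
   theorem of calculus and the profile equation is an algebraic identity. *)

Require Import Defs.
From HB Require Import structures.
From mathcomp Require Import all_boot all_order all_algebra.
From mathcomp Require Import all_classical all_reals all_analysis.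
From mathcomp Require Import measurable_realfun ring lra.
Import Order.TTheory GRing.Theory Num.Theory.
Import numFieldNormedType.Exports.
Local Open Scope classical_set_scope.
Local Open Scope ring_scope.

Set Implicit Arguments.
Unset Strict Implicit.

(** * Calculus of derivatives and sign arguments on open intervals *)

Section derivatives.
Context {R : realType}.
Implicit Types (f g : R -> R) (x : R).

(** For X > 1 each side of the singularity contributes an integral that diverges logarithmically in
    eps. Adding ln (1 - x) to [ibeta] removes the divergence from each side separately, and the two
    logarithms cancel in the limit because the truncation is symmetric. The resulting constants have
    a pole at 0, so the difference in the reflection formula is not visibly Lipschitz. The
    recurrence is therefore applied twice: once to expose the pole 1/x that matches that of the
    cotangent, once more to raise the exponents to at least 1, where (x^p - x^q) / (1 - x) is
    bounded by q - p all the way down to x = 0. On each piece of the domain the integrand has a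
    constant sign, so exhaustion by compact intervals and monotone convergence give integrability
    and value together. *)

Lemma is_derive1D f g x a b : is_derive x 1 f a -> is_derive x 1 g b ->
  is_derive x 1 (fun t => f t + g t) (a + b).
Proof. by move=> df dg; exact: is_deriveD. Qed.

Lemma is_derive1B f g x a b : is_derive x 1 f a -> is_derive x 1 g b ->
  is_derive x 1 (fun t => f t - g t) (a - b).
Proof. by move=> df dg; exact: is_deriveB. Qed.

Lemma is_derive1M f g x a b : is_derive x 1 f a -> is_derive x 1 g b ->
  is_derive x 1 (fun t => f t * g t) (a * g x + f x * b).
Proof.
move=> df dg; have h := is_deriveM df dg.
by apply: is_derive_eq; rewrite addrC /GRing.scale/= [g x * a]mulrC.
Qed.

Lemma is_derive1Zl f (k : R) x a :
  is_derive x 1 f a -> is_derive x 1 (fun t => k * f t) (k * a).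
Proof. by move=> df; exact: is_deriveZ. Qed.

Lemma is_derive1V f x a : f x != 0 ->
  is_derive x 1 f a -> is_derive x 1 (fun t => (f t)^-1) (- a / f x ^+ 2).
Proof.
by move=> fx df; apply: is_derive_eq (is_deriveV fx df) _; rewrite scaleNr mulNr mulrC.
Qed.

Lemma is_derive1_chain f g x a b : is_derive (g x) 1 f a ->
  is_derive x 1 g b -> is_derive x 1 (fun t => f (g t)) (a * b).
Proof. by move=> df dg; exact: is_derive1_comp. Qed.

Lemma is_derive1_affine (k c x : R) : is_derive x 1 (fun t => k * t + c) k.
Proof.
rewrite -[X in is_derive _ _ _ X]addr0; apply: is_derive1D.
by rewrite -[X in is_derive _ _ _ X]mulr1; apply: is_derive1Zl.
Qed.

Lemma is_derive1_continuous f x a : is_derive x 1 f a -> {for x, continuous f}.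
Proof. by move=> df; exact/differentiable_continuous/derivable1_diffP. Qed.

Lemma is_derive1_derive1 f x a : is_derive x 1 f a -> derive1 f x = a.
Proof. by move=> df; rewrite derive1E derive_val. Qed.

Lemma is_derive_ge0_homo f df a b :
  (forall x, a < x < b -> is_derive x 1 f (df x)) ->
  (forall x, a < x < b -> 0 <= df x) ->
  forall x y, a < x -> x <= y -> y < b -> f x <= f y.
Proof.
move=> fdf df0 x y ax xy yb.
have D z : z \in `]a, b[%R -> derivable f z 1.
  by rewrite in_itv/= => /fdf ?; exact: ex_derive.
apply: (@ger0_derive1_le_oo _ f a b) => //.
- move=> z; rewrite in_itv/= => zab; rewrite (is_derive1_derive1 (fdf _ zab)).
  exact: df0.
- move=> z; rewrite inE/= in_itv/= => zab.
  exact: is_derive1_continuous (fdf _ zab).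
- by rewrite in_itv/= ax (le_lt_trans xy).
- by rewrite in_itv/= yb (lt_le_trans ax).
Qed.

(** The left end enters only through a limit, since powers x^p with 0 < p < 1 are not differentiable
    at 0. Monotonicity gives f y <= f x for y close to [a], and the inequality passes to the
    limit. *)
Lemma is_derive_ge0_ge0 f df a b :
  (forall x, a < x < b -> is_derive x 1 f (df x)) ->
  (forall x, a < x < b -> 0 <= df x) ->
  f x @[x --> a^'+] --> 0 -> forall x, a < x < b -> 0 <= f x.
Proof.
move=> fdf df0 fa x /andP[ax xb].
apply: (cvgr_to_le fa).
near=> y; apply: (@is_derive_ge0_homo f df a b) => //; near: y.
exact: nbhs_right_le.
Unshelve. all: by end_near. Qed.

(** Uniqueness principle behind the identities for [ibeta]: the difference of the two sides has
    derivative 0 and tends to 0 at the left end. *)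
Lemma is_derive0_eq0 f a b :
  (forall x, a < x < b -> is_derive x 1 f 0) ->
  f x @[x --> a^'+] --> 0 -> forall x, a < x < b -> f x = 0.
Proof.
move=> f0 fa x xab; apply/eqP; rewrite eq_le -oppr_ge0; apply/andP; split.
  apply: (@is_derive_ge0_ge0 (fun t => - f t) (cst 0) a b) => //.
    by move=> y /f0 ?; rewrite -oppr0; exact: is_deriveN.
  by rewrite -oppr0; exact: cvgN.
exact: (@is_derive_ge0_ge0 f (cst 0) a b).
Qed.

End derivatives.

(** * The incomplete beta function as a power series *)

Section incomplete_beta.
Context {R : realType}.
Implicit Types (a x : R).

Definition ibeta_coef a : R^nat := fun n => (n%:R + a)^-1.

(* The incomplete beta function B(x; a, 0), i.e. the integral of
   t `^ (a - 1) / (1 - t) between 0 and x. *)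
Definition ibeta a x : R := x `^ a * limn (pseries (ibeta_coef a) x).

Lemma bernoulli_natr (d : R) n : 0 <= d -> 1 + n%:R * d <= (1 + d) ^+ n.
Proof.
move=> d0; elim: n => [|n ih]; first by rewrite mul0r addr0.
rewrite exprS (le_trans _ (ler_wpM2l _ ih)) ?addr_ge0// -natr1.
have : 0 <= d * d * n%:R by rewrite !mulr_ge0.
by nra.
Qed.

(** With k = |x| and d = 1 - k, Bernoulli's inequality gives (n+1) d <= (1+d)^n, so the terms are
    dominated by a geometric series of ratio (1+d) k = 1 - d^2 < 1. Linear growth of the
    coefficients covers the beta series and its first two termwise derivatives. *)
Lemma is_cvg_pseries_linear (c : R^nat) M x : `|x| < 1 -> 0 <= M ->
  (forall n, `|c n| <= M * n.+1%:R) -> cvgn (pseries c x).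
Proof.
move=> x1 M0 cM; set k := `|x| in x1.
have k0 : 0 <= k by exact: normr_ge0.
have d0 : 0 < 1 - k by rewrite subr_gt0.
apply: normed_cvg.
pose v := geometric (M / (1 - k)) ((1 + (1 - k)) * k).
have v0 n : 0 <= v n.
  rewrite /v /=; apply: mulr_ge0; first by apply: divr_ge0 => //; exact: ltW.
  by apply/exprn_ge0/mulr_ge0 => //; lra.
apply: (@series_le_cvg _ _ v) => // [n|n|]; first exact: normr_ge0.
  rewrite /v /= normrM normrX -/k exprMn mulrA ler_wpM2r ?exprn_ge0//.
  rewrite (le_trans (cM n))// mulrAC -mulrA ler_wpM2l//.
  rewrite ler_pdivlMr// (le_trans _ (bernoulli_natr n (ltW d0)))//.
  by rewrite -natr1; lra.
apply: is_cvg_geometric_series.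
by rewrite ger0_norm; nra.
Qed.

Lemma natrD_gt0 a : 0 < a -> forall n, 0 < n%:R + a.
Proof. by move=> a0 n; rewrite ltr_wpDl. Qed.

Lemma is_cvg_ibeta_coef a x : 0 < a -> `|x| < 1 ->
  cvgn (pseries (ibeta_coef a) x).
Proof.
move=> a0 x1; apply: (@is_cvg_pseries_linear _ a^-1) => //; first by rewrite invr_ge0 ltW.
move=> n; rewrite /ibeta_coef ger0_norm ?invr_ge0 ?(ltW (natrD_gt0 a0 n))//.
rewrite (@le_trans _ _ a^-1)// ?lef_pV2 ?posrE ?natrD_gt0// ?lerDr//.
by rewrite ler_peMr ?invr_ge0 ?(ltW a0)// ler1n.
Qed.

Lemma is_cvg_ibeta_diffs a x : 0 < a -> `|x| < 1 ->
  cvgn (pseries (pseries_diffs (ibeta_coef a)) x).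
Proof.
move=> a0 x1; apply: (@is_cvg_pseries_linear _ 1) => // n.
rewrite /pseries_diffs /ibeta_coef mul1r normrM [X in _ * X]ger0_norm; last first.
  by rewrite invr_ge0 ltW ?natrD_gt0.
rewrite normr_nat ler_pdivrMr ?natrD_gt0// ler_peMr//.
by rewrite -natr1; have := ler0n R n; lra.
Qed.

Lemma is_cvg_ibeta_diffs2 a x : 0 < a -> `|x| < 1 ->
  cvgn (pseries (pseries_diffs (pseries_diffs (ibeta_coef a))) x).
Proof.
move=> a0 x1; apply: (@is_cvg_pseries_linear _ 1) => // n.
rewrite /pseries_diffs /ibeta_coef mul1r mulrA normrM [X in _ * X]ger0_norm; last first.
  by rewrite invr_ge0 ltW ?natrD_gt0.
rewrite -natrM normr_nat ler_pdivrMr ?natrD_gt0// natrM ler_wpM2l//.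
by lra.
Qed.

Lemma is_derive_ibeta_series a x : 0 < a -> `|x| < 1 ->
  is_derive x 1 (fun t => limn (pseries (ibeta_coef a) t))
    (limn (pseries (pseries_diffs (ibeta_coef a)) x)).
Proof.
move=> a0 x1; have ? := normr_ge0 x.
have K0 : 0 <= (1 + `|x|) / 2 by lra.
have K1 : `|(1 + `|x|) / 2| < 1 by rewrite ger0_norm; lra.
apply: (@pseries_snd_diffs _ _ ((1 + `|x|) / 2)).
- exact: is_cvg_ibeta_coef.
- exact: is_cvg_ibeta_diffs.
- exact: is_cvg_ibeta_diffs2.
- by rewrite [ltRHS]ger0_norm; lra.
Qed.

(** Coefficientwise a/(n+a) + n/(n+a) = 1, so the left side is the geometric series. The derivative
    of x^a S(x) is x^(a-1) (a S + x S'), and this equation puts it in closed form. *)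
Lemma ibeta_series_ode a x : 0 < a -> `|x| < 1 ->
  a * limn (pseries (ibeta_coef a) x) +
  x * limn (pseries (pseries_diffs (ibeta_coef a)) x) = (1 - x)^-1.
Proof.
move=> a0 x1.
have c1 := is_cvg_ibeta_coef a0 x1.
have c2 := pseries_diffs_equiv (is_cvg_ibeta_diffs a0 x1).
suff -> : (1 - x)^-1 = limn ((fun=> a) \* pseries (ibeta_coef a) x +
    (fun=> x) \* series (fun i => i%:R * ibeta_coef a i * x ^+ i.-1)).
  apply/esym/cvg_lim => //; apply: cvgD; first by apply: cvgM => //; exact: cvg_cst.
  by apply: cvgM => //; exact: cvg_cst.
rewrite (_ : _ + _ = series (geometric 1 x)).
  by rewrite -[LHS]mul1r; apply/esym/cvg_lim => //; exact: cvg_geometric_series.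
apply/funext => n; rewrite /pseries /series !fctE /= !mulr_sumr -big_split/=.
(* At index 0 the predecessor is truncated and x * x^(i-1) = x^i fails; the factor i kills that
   term. *)
apply: eq_bigr => -[|i] _ /=.
  rewrite expr0 /ibeta_coef mul0r add0r mul0r mulr0 addr0.
  by rewrite !mulr1 divff// gt_eqF.
rewrite /ibeta_coef mul1r exprS.
have : i.+1%:R + a != 0 by rewrite gt_eqF// natrD_gt0.
by move: i.+1%:R => k h; field.
Qed.

Lemma is_derive_ibeta a x : 0 < a -> 0 < x < 1 ->
  is_derive x 1 (ibeta a) (x `^ (a - 1) / (1 - x)).
Proof.
move=> a0 /andP[x0 x1].
have nx : `|x| < 1 by rewrite gtr0_norm.
apply: is_derive_eq.
  apply: is_derive1M (is_derive1_powR _ x0) (is_derive_ibeta_series a0 nx).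
rewrite -(ibeta_series_ode a0 nx) mulrDr -(mulr_powRB1 (ltW x0) a0).
by ring.
Qed.

Lemma ibeta_cvg0 a : 0 < a -> ibeta a x @[x --> 0^'+] --> 0.
Proof.
move=> a0; rewrite -[X in _ --> X](mul0r (limn (pseries (ibeta_coef a) 0))).
rewrite (_ : ibeta a = (fun x => x `^ a) \* (fun x => limn (pseries (ibeta_coef a) x)))//.
apply: cvgM; first exact: powR_cvg0.
apply: cvg_at_right_filter.
have n0 : `|0 : R| < 1 by rewrite normr0.
exact: is_derive1_continuous (is_derive_ibeta_series a0 n0).
Qed.

End incomplete_beta.

(** * Composition with one-sided limits *)

Section one_sided_limits.
Context {R : realType}.
Implicit Types (f g : R -> R).

(** The strict inequality keeps g inside the one-sided neighbourhood, which its convergence alone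
    does not ensure. *)
Lemma cvg_comp_at_right (T : Type) (F : set_system T) {FF : Filter F}
    (g : T -> R) f (b l : R) :
  g @ F --> b -> (\forall x \near F, b < g x) ->
  f x @[x --> b^'+] --> l -> f (g x) @[x --> F] --> l.
Proof.
move=> gb gtb fl; apply: (@cvg_comp _ _ _ g f _ b^'+) => //.
move=> A bA; apply: filterS2 gtb (gb _ bA) => x gx; exact.
Qed.

Lemma cvg_comp_at_left (T : Type) (F : set_system T) {FF : Filter F}
    (g : T -> R) f (b l : R) :
  g @ F --> b -> (\forall x \near F, g x < b) ->
  f x @[x --> b^'-] --> l -> f (g x) @[x --> F] --> l.
Proof.
move=> gb gtb fl; apply: (@cvg_comp _ _ _ g f _ b^'-) => //.
move=> A bA; apply: filterS2 gtb (gb _ bA) => x gx; exact.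
Qed.

Lemma cvg_sqr_at_right0 : (x : R) ^+ 2 @[x --> (0 : R)^'+] --> (0 : R).
Proof.
rewrite -[X in _ --> X](expr0n _ 2); apply: cvg_at_right_filter.
exact: exprn_continuous.
Qed.

Lemma cvg_sqr_at_left1 : (x : R) ^+ 2 @[x --> (1 : R)^'-] --> (1 : R).
Proof.
rewrite -[X in _ --> X](expr1n _ 2); apply: cvg_at_left_filter.
exact: exprn_continuous.
Qed.

End one_sided_limits.

(** * Recurrence, duplication and monotonicity of the incomplete beta function *)

Section ibeta_identities.
Context {R : realType}.
Implicit Types (a b x : R).

Lemma is_derive_ln1B x : x < 1 -> is_derive x 1 (fun t => ln (1 - t)) (- (1 - x)^-1).
Proof.
move=> x1; rewrite -mulrN1; apply: is_derive1_chain.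
  by apply: is_derive1_ln; rewrite subr_gt0.
by rewrite -[X in is_derive _ _ _ X]add0r; apply: is_derive1B.
Qed.

Lemma ibeta1E x : 0 < x < 1 -> ibeta 1 x = - ln (1 - x).
Proof.
move=> x01; apply/eqP; rewrite -addr_eq0; apply/eqP; move: x x01.
apply: is_derive0_eq0 => [x /andP[x0 x1]|].
  apply: is_derive_eq.
    apply: is_derive1D (is_derive_ln1B x1); apply: is_derive_ibeta => //.
    by rewrite x0.
  by rewrite subrr powRr0 mul1r subrr.
rewrite -[X in _ --> X]addr0; apply: cvgD; first exact: ibeta_cvg0.
rewrite -[X in _ --> X](@ln1 R) -[in X in _ --> X](subr0 1).
by apply: cvg_at_right_filter; apply: is_derive1_continuous (is_derive_ln1B ltr01).
Qed.

(** The two integrands differ by t^(a-1). In the limit x -> 1 this recurrence isolates the pole 1/a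
    of the constant. *)
Lemma ibetaS a x : 0 < a -> 0 < x < 1 -> ibeta a x = x `^ a / a + ibeta (a + 1) x.
Proof.
move=> a0 x01; apply/eqP; rewrite -subr_eq0; apply/eqP; move: x x01.
apply: is_derive0_eq0 => [x /andP[x0 x1]|].
  have x01 : 0 < x < 1 by rewrite x0.
  apply: is_derive_eq.
    apply: is_derive1B (is_derive_ibeta a0 x01) _.
    apply: is_derive1D; last by apply: is_derive_ibeta => //; rewrite addr_gt0.
    apply: is_derive1M (is_derive1_powR _ x0) _.
  rewrite addrK -[x `^ a](mulr_powRB1 (ltW x0) a0).
  by field; rewrite subr_eq0 !gt_eqF.
rewrite -[X in _ --> X]subr0; apply: cvgB; first exact: ibeta_cvg0.
rewrite -[X in _ --> X]addr0; apply: cvgD; last by apply: ibeta_cvg0; rewrite addr_gt0.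
rewrite -[X in _ --> X](mul0r a^-1); apply: cvgM; last exact: cvg_cst.
exact: powR_cvg0.
Qed.

Lemma is_derive1_sqr x : is_derive x 1 (fun t => t ^+ 2) (2 * x).
Proof.
by apply: is_derive_eq (is_derive1M (is_derive_id x 1) (is_derive_id x 1)) _; ring.
Qed.

Lemma is_derive_ibeta_sqr a x : 0 < a -> 0 < x < 1 ->
  is_derive x 1 (fun t => ibeta (a / 2) (t ^+ 2)) (2 * x `^ (a - 1) / (1 - x ^+ 2)).
Proof.
move=> a0 /andP[x0 x1].
have xx : 0 < x ^+ 2 < 1 by rewrite exprn_gt0//= expr_lt1// ltW.
apply: is_derive_eq.
  apply: (@is_derive1_chain _ (ibeta (a / 2))) (is_derive1_sqr x).
  by apply: is_derive_ibeta xx; rewrite divr_gt0.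
have -> : (x ^+ 2) `^ (a / 2 - 1) = x `^ (a - 1) / x.
  rewrite -powR_mulrn ?(ltW x0)// -powRrM (_ : 2%:R * _ = (a - 1) - 1); last by lra.
  by rewrite powRB ?(gt_eqF x0) ?implybT// powRr1// ltW.
by field; rewrite subr_eq0 !gt_eqF//; case/andP: xx.
Qed.

(** After the substitution of t^2 the integrands on the left are 2 t^(a-1) / (1-t^2) and 2 t^a /
    (1-t^2), whose sum is 2 t^(a-1) / (1-t). *)
Lemma ibeta_duplication a x : 0 < a -> 0 < x < 1 ->
  ibeta (a / 2) (x ^+ 2) + ibeta ((a + 1) / 2) (x ^+ 2) = 2 * ibeta a x.
Proof.
move=> a0 x01; apply/eqP; rewrite -subr_eq0; apply/eqP; move: x x01.
have a1 : 0 < a + 1 by rewrite addr_gt0.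
apply: is_derive0_eq0 => [x /andP[x0 x1]|].
  have x01 : 0 < x < 1 by rewrite x0.
  apply: is_derive_eq.
    apply: is_derive1B; first by apply: is_derive1D; exact: is_derive_ibeta_sqr.
    by apply: is_derive1Zl; exact: is_derive_ibeta.
  rewrite addrK -[x `^ a](mulr_powRB1 (ltW x0) a0).
  rewrite (_ : 1 - x ^+ 2 = (1 - x) * (1 + x)); last by ring.
  by field; rewrite subr_eq0 !gt_eqF// addr_gt0.
rewrite -[X in _ --> X]subr0 -[X in _ --> _ - X](mulr0 2); apply: cvgB; last first.
  by apply: cvgM; [exact: cvg_cst | exact: ibeta_cvg0].
rewrite -[X in _ --> X]addr0.
by apply: cvgD; apply: cvg_comp_at_right (@cvg_sqr_at_right0 R) _ _;
  (try by apply: ibeta_cvg0; rewrite divr_gt0);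
  near=> y; rewrite exprn_gt0.
Unshelve. all: by end_near. Qed.

(** With d = b - a, 1 - x^d <= - d ln x <= d (1/x - 1), and the factor x^(a+1) <= x absorbs 1/x. The
    extra 1 in the exponents is what provides this factor. *)
Lemma powR_diff_le a b x : 0 <= a -> a <= b -> 0 < x < 1 ->
  0 <= x `^ (a + 1) - x `^ (b + 1) <= (b - a) * (1 - x).
Proof.
move=> a0 ab /andP[x0 x1].
have -> : b + 1 = a + (b - a) + 1 by lra.
have d0 : 0 <= b - a by rewrite subr_ge0.
move: (b - a) d0 => d d0 {b ab}.
rewrite subr_ge0 ger_powR ?x0 ?(ltW x1)//=; last by lra.
have -> : a + d + 1 = (a + 1) + d by lra.
rewrite (@powRD _ x (a + 1) d); last by rewrite (gt_eqF x0) implybT.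
rewrite -{1}[x `^ (a + 1)]mulr1 -mulrBr.
have h1 : x `^ (a + 1) <= x.
  by apply: ge1r_powR; [rewrite x0 ltW | lra].
have h2 : 1 + d * ln x <= x `^ d by rewrite /powR gt_eqF// expR_ge1Dx.
have h3 : - ln x <= x^-1 - 1.
  rewrite -lnV ?posrE// -{1}[x^-1](subrK 1) addrC le_ln1Dx//.
  by rewrite ltrBrDr addrC subrr invr_gt0.
have h4 : x `^ d <= 1 by rewrite -(powRr0 x) ger_powR// x0 ltW.
apply: (@le_trans _ _ (x * (1 - x `^ d))); first by rewrite ler_wpM2r// subr_ge0.
apply: (@le_trans _ _ (x * (d * (x^-1 - 1)))).
  rewrite ler_wpM2l ?(ltW x0)//; have := ler_wpM2l d0 h3; lra.
by rewrite le_eqVlt; apply/orP; left; apply/eqP; field; rewrite gt_eqF.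
Qed.

Lemma is_derive_ibeta2B a b x : 0 <= a -> 0 <= b -> 0 < x < 1 ->
  is_derive x 1 (fun t => ibeta (a + 2) t - ibeta (b + 2) t)
    ((x `^ (a + 1) - x `^ (b + 1)) / (1 - x)).
Proof.
move=> a0 b0 x01; apply: is_derive_eq.
  by apply: is_derive1B; apply: is_derive_ibeta x01; rewrite ltr_wpDl.
by rewrite -mulrBl; congr ((_ `^ _ - _ `^ _) / _); lra.
Qed.

Lemma ibeta2B_homo a b : 0 <= a -> a <= b -> forall x y, 0 < x -> x <= y -> y < 1 ->
  ibeta (a + 2) x - ibeta (b + 2) x <= ibeta (a + 2) y - ibeta (b + 2) y.
Proof.
move=> a0 ab; apply: is_derive_ge0_homo => x x01.
  by apply: is_derive_ibeta2B => //; exact: le_trans ab.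
have /andP[h _] := powR_diff_le a0 ab x01.
by rewrite divr_ge0// subr_ge0 ltW//; case/andP: x01.
Qed.

Lemma ibeta2B_cvg0 a b : 0 <= a -> 0 <= b ->
  (ibeta (a + 2) x - ibeta (b + 2) x) @[x --> 0^'+] --> 0.
Proof.
move=> a0 b0; rewrite -[X in _ --> X]subr0.
by apply: cvgB; apply: ibeta_cvg0; rewrite ltr_wpDl.
Qed.

(** The derivative lies between 0 and b - a by [powR_diff_le], and the difference tends to 0 at the
    left end. *)
Lemma ibeta2B_bound a b x : 0 <= a -> a <= b -> 0 < x < 1 ->
  0 <= ibeta (a + 2) x - ibeta (b + 2) x <= (b - a) * x.
Proof.
move=> a0 ab x01; have b0 := le_trans a0 ab; apply/andP; split; move: x x01; last first.
  move=> x x01; rewrite -subr_ge0; move: x x01.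
  apply: (@is_derive_ge0_ge0 _ _ (fun x => (b - a) * 1 -
    (x `^ (a + 1) - x `^ (b + 1)) / (1 - x))) => [x x01|x x01|].
  - apply: is_derive1B; last exact: is_derive_ibeta2B.
  - have /andP[_ h] := powR_diff_le a0 ab x01.
    case/andP: x01 => _ x1; rewrite mulr1 subr_ge0 ler_pdivrMr// subr_gt0//.
  rewrite -[X in _ --> X]subr0; apply: cvgB; last exact: ibeta2B_cvg0.
  rewrite -[X in _ --> X](mulr0 (b - a)); apply: cvgM; first exact: cvg_cst.
  by apply: cvg_at_right_filter; exact: cvg_id.
apply: is_derive_ge0_ge0 => [x|x x01|]; last exact: ibeta2B_cvg0.
  exact: is_derive_ibeta2B.
have /andP[h _] := powR_diff_le a0 ab x01.
by rewrite divr_ge0// subr_ge0 ltW//; case/andP: x01.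
Qed.

End ibeta_identities.

(** * The renormalised value of the incomplete beta function at 1 *)

Section ibeta_constant.
Context {R : realType}.
Implicit Types (a b x : R).

(* Equal to minus (the digamma function at [a] plus Euler's constant). *)
Definition ibeta_cst a : R := lim ((ibeta a x + ln (1 - x)) @[x --> (1 : R)^'-]).

Lemma near_left1 (P : R -> Prop) : (forall x, 0 < x < 1 -> P x) ->
  \forall x \near (1 : R)^'-, P x.
Proof. by move=> h; near=> x; apply: h; apply/andP; split. Unshelve. all: by end_near. Qed.

Lemma powR_cvg1 a : (x : R) `^ a @[x --> (1 : R)^'-] --> (1 : R).
Proof.
rewrite -[X in _ --> X](_ : 1 `^ a = 1); last by rewrite powR1.
apply: cvg_at_left_filter.
exact: is_derive1_continuous (is_derive1_powR a (@ltr01 R)).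
Qed.

(** The logarithm is minus [ibeta 1 x]. One recurrence step for 1 and two for [a] leave elementary
    terms and a difference that is monotone and bounded, so that the limit at 1 exists. *)
Lemma ibeta_lnE a x : 0 < a -> 0 < x < 1 -> ibeta a x + ln (1 - x) =
  x `^ a / a + x `^ (a + 1) / (a + 1) - x - (ibeta (0 + 2) x - ibeta (a + 2) x).
Proof.
move=> a0 x01; have /andP[x0 x1] := x01.
have := ibeta1E x01; have := ibetaS (@ltr01 R) x01; have := ibetaS a0 x01.
have := @ibetaS R (a + 1) x (addr_gt0 a0 ltr01) x01.
rewrite powRr1 ?(ltW x0)// divr1 add0r -addrA -[1 + 1]/(2%:R).
by lra.
Qed.

Lemma ibeta_cst_cvg a : 0 < a ->
  (ibeta a x + ln (1 - x)) @[x --> (1 : R)^'-] --> ibeta_cst a.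
Proof.
move=> a0; suff [l hl] : exists l : R, (ibeta a x + ln (1 - x)) @[x --> (1 : R)^'-] --> l.
  by rewrite /ibeta_cst (cvg_lim _ hl).
have : cvg ((ibeta (0 + 2) x - ibeta (a + 2) x) @[x --> (1 : R)^'-]).
  apply: nondecreasing_at_left_is_cvgr.
    apply: near_left1 => x /andP[x0 x1] y z; rewrite !in_itv/= => /andP[xy y1] /andP[xz z1] yz.
    by apply: ibeta2B_homo => //; [exact: ltW | exact: lt_trans xy].
  apply: near_left1 => x /andP[x0 x1]; exists a => _ [y /= + <-].
  rewrite in_itv/= => /andP[xy y1].
  have y01 : 0 < y < 1 by rewrite (lt_trans x0 xy).
  have /andP[_ h] := ibeta2B_bound (lexx 0) (ltW a0) y01.
  by rewrite (le_trans h)// subr0 ger_pMr// ltW.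
move=> /cvg_ex[/= d hd]; exists (1 / a + 1 / (a + 1) - 1 - d).
have : (x `^ a / a + x `^ (a + 1) / (a + 1) - x -
    (ibeta (0 + 2) x - ibeta (a + 2) x)) @[x --> (1 : R)^'-]
    --> 1 / a + 1 / (a + 1) - 1 - d.
  apply: cvgB hd; apply: cvgB; last by apply: cvg_at_left_filter; exact: cvg_id.
  by apply: cvgD; apply: cvgM; (try exact: cvg_cst); exact: powR_cvg1.
apply: cvg_trans; apply: near_eq_cvg; apply: near_left1 => x x01.
by rewrite ibeta_lnE.
Qed.

Lemma ibeta_cstS2 a : 0 < a -> ibeta_cst a = 1 / a + 1 / (a + 1) + ibeta_cst (a + 2).
Proof.
move=> a0.
have a2 : 0 < a + 2 by rewrite addr_gt0.
apply: (cvg_unique _ (ibeta_cst_cvg a0)) => //.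
have : (x `^ a / a + x `^ (a + 1) / (a + 1) + (ibeta (a + 2) x + ln (1 - x)))
    @[x --> (1 : R)^'-] --> 1 / a + 1 / (a + 1) + ibeta_cst (a + 2).
  apply: cvgD; last exact: ibeta_cst_cvg.
  by apply: cvgD; apply: cvgM; (try exact: cvg_cst); exact: powR_cvg1.
apply: cvg_trans; apply: near_eq_cvg; apply: near_left1 => x x01.
have := ibetaS a0 x01; have := @ibetaS R (a + 1) x (addr_gt0 a0 ltr01) x01.
by rewrite -addrA -[1 + 1]/(2%:R); lra.
Qed.

(** Limit of [ibeta2B_bound] as x tends to 1; the logarithms cancel in the difference. *)
Lemma ibeta_cst_lipschitz a b : 0 <= a -> a <= b ->
  `|ibeta_cst (a + 2) - ibeta_cst (b + 2)| <= b - a.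
Proof.
move=> a0 ab; have b0 := le_trans a0 ab.
have a2 : 0 < a + 2 by rewrite ltr_wpDl.
have b2 : 0 < b + 2 by rewrite ltr_wpDl.
have h : (ibeta (a + 2) x + ln (1 - x) - (ibeta (b + 2) x + ln (1 - x)))
    @[x --> (1 : R)^'-] --> ibeta_cst (a + 2) - ibeta_cst (b + 2).
  by apply: cvgB; exact: ibeta_cst_cvg.
rewrite ler_norml; apply/andP; split.
  apply: (@le_trans _ _ 0); first by rewrite oppr_le0 subr_ge0.
  apply: (cvgr_to_ge h); apply: near_left1 => x x01.
  by have := ibeta2B_bound a0 ab x01; lra.
apply: (cvgr_to_le h); apply: near_left1 => x x01.
have /andP[x0 x1] := x01.
have := ibeta2B_bound a0 ab x01.
have : (b - a) * x <= b - a by rewrite ler_piMr ?subr_ge0// ltW.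
by lra.
Qed.

Lemma ibeta_cst_sqr_cvg a : 0 < a ->
  (ibeta a (x ^+ 2) + ln (1 - x ^+ 2)) @[x --> (1 : R)^'-] --> ibeta_cst a.
Proof.
move=> a0; apply: (cvg_comp_at_left (@cvg_sqr_at_left1 R)) (ibeta_cst_cvg a0).
by apply: near_left1 => x /andP[x0 x1]; rewrite expr_lt1// ltW.
Qed.

Lemma ln1D_cvg : ln (1 + x) @[x --> (1 : R)^'-] --> ln (2 : R).
Proof.
apply: (@cvg_at_left_filter R _ (fun x : R => ln (1 + x)) 1).
apply: (@continuous_comp _ _ _ (fun x : R => 1 + x)).
  by apply: continuousD; [exact: cst_continuous | exact: cvg_id].
exact: continuous_ln.
Qed.

(** The duplication of [ibeta] evaluates the left side at x^2, and 1 - x^2 = (1-x)(1+x): each of the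
    two logarithms leaves ln (1+x), whence 2 ln 2. For the digamma function this is Legendre's
    duplication formula. *)
Lemma ibeta_cst_duplication a : 0 < a ->
  ibeta_cst (a / 2) + ibeta_cst ((a + 1) / 2) = 2 * ibeta_cst a + 2 * ln 2.
Proof.
move=> a0; have a1 : 0 < a + 1 by rewrite addr_gt0.
have h1 : (ibeta (a / 2) (x ^+ 2) + ln (1 - x ^+ 2) +
  (ibeta ((a + 1) / 2) (x ^+ 2) + ln (1 - x ^+ 2))) @[x --> (1 : R)^'-] -->
  ibeta_cst (a / 2) + ibeta_cst ((a + 1) / 2).
  by apply: cvgD; apply: ibeta_cst_sqr_cvg; rewrite divr_gt0.
apply: (cvg_unique _ h1) => //.
have : (2 * (ibeta a x + ln (1 - x)) + 2 * ln (1 + x)) @[x --> (1 : R)^'-] -->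
  2 * ibeta_cst a + 2 * ln 2.
  apply: cvgD; apply: cvgM; (try exact: cvg_cst); first exact: ibeta_cst_cvg.
  exact: ln1D_cvg.
apply: cvg_trans; apply: near_eq_cvg; apply: near_left1 => x x01.
have := ibeta_duplication a0 x01.
have /andP[x0 x1] := x01.
rewrite (_ : 1 - x ^+ 2 = (1 - x) * (1 + x)); last by ring.
by rewrite lnM ?posrE ?subr_gt0 ?addr_gt0//; lra.
Qed.

(* The limit of the integral of t `^ (a - 1) / (1 + t) between 0 and x. *)
Lemma ibeta_alt_cvg a : 0 < a ->
  (ibeta (a / 2) (x ^+ 2) - ibeta a x) @[x --> (1 : R)^'-] -->
  ibeta_cst (a / 2) - ibeta_cst a - ln 2.
Proof.
move=> a0.
have : (ibeta (a / 2) (x ^+ 2) + ln (1 - x ^+ 2) - (ibeta a x + ln (1 - x)) - ln (1 + x))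
  @[x --> (1 : R)^'-] --> ibeta_cst (a / 2) - ibeta_cst a - ln 2.
  apply: cvgB ln1D_cvg; apply: cvgB; last exact: ibeta_cst_cvg.
  by apply: ibeta_cst_sqr_cvg; rewrite divr_gt0.
apply: cvg_trans; apply: near_eq_cvg; apply: near_left1 => x x01.
have /andP[x0 x1] := x01.
rewrite (_ : 1 - x ^+ 2 = (1 - x) * (1 + x)); last by ring.
by rewrite lnM ?posrE ?subr_gt0 ?addr_gt0//; lra.
Qed.

End ibeta_constant.

(** * Reflection formula by Herglotz's trick *)

Section cotangent.
Context {R : realType}.
Implicit Types (x y : R).

Lemma mul_cos_le_sin_le y : 0 < y <= pi / 2 -> y * cos y <= sin y <= y.
Proof.
move=> /andP[y0 ypi].
have [c] := @MVT R sin cos 0 y y0 (fun x _ => is_derive_sin x)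
  (continuous_subspaceT (@continuous_sin R)).
rewrite in_itv/= sin0 !subr0 => /andP[c0 cy] ->.
have cpi : c < pi by have := @pi_gt0 R; lra.
have : cos y < cos c.
  by rewrite ltr_cos// in_itv/= ?(ltW c0) ?(ltW y0)/= ?(ltW cpi)//; have := @pi_gt0 R; lra.
by have := cos_le1 c; nra.
Qed.

(** Square y cos y <= sin y <= y at y = pi x and replace cos^2 by 1 - sin^2. The double pole at 0 is
    thus 1/x^2 up to an error of at most pi^2. *)
Lemma sin_pi_bounds x : 0 < x <= 1 / 2 ->
  x ^- 2 <= pi ^+ 2 / sin (pi * x) ^+ 2 <= x ^- 2 + pi ^+ 2.
Proof.
move=> /andP[x0 x2]; have p0 := @pi_gt0 R.
have y0 : 0 < pi * x by rewrite mulr_gt0.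
have yp : pi * x <= pi / 2 by rewrite ler_pM2l//; lra.
have /andP[l u] : pi * x * cos (pi * x) <= sin (pi * x) <= pi * x.
  by apply: mul_cos_le_sin_le; rewrite y0.
have s0 : 0 < sin (pi * x) by apply: sin_gt0_pi; rewrite y0; lra.
have c0 : 0 <= cos (pi * x) by apply: cos_ge0_pihalf; rewrite yp andbT; lra.
have E := cos2Dsin2 (pi * x).
move: (sin _) (cos _) s0 c0 l u E => s c s0 c0 l u E.
have ss : 0 < s ^+ 2 by rewrite exprn_gt0.
have xx : 0 < x ^+ 2 by rewrite exprn_gt0.
have h1 : s ^+ 2 <= (pi * x) ^+ 2 by rewrite lerXn2r// nnegrE ltW.
have h2 : (pi * x * c) ^+ 2 <= s ^+ 2.
  by rewrite lerXn2r// nnegrE ?(ltW s0)// mulr_ge0// ltW.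
apply/andP; split.
  rewrite -[x ^- 2]div1r ler_pdivlMr// mulrAC ler_pdivrMr//; move: h1; rewrite exprMn; lra.
have -> : x ^- 2 + pi ^+ 2 = (1 + (pi * x) ^+ 2) / x ^+ 2 by field; rewrite gt_eqF.
rewrite ler_pdivlMr// mulrAC ler_pdivrMr//; move: h2; rewrite !exprMn.
by have -> : s ^+ 2 = 1 - c ^+ 2; lra.
Qed.

(** The principal parts of pi cot (pi x) at 0 and 1, minus that function; the derivative stays
    bounded up to both ends. *)
Definition cot_reg x := x^-1 - (1 - x)^-1 - pi * (cos (pi * x) / sin (pi * x)).

Lemma sin_pi_gt0 x : 0 < x < 1 -> 0 < sin (pi * x).
Proof.
move=> /andP[x0 x1]; have p0 := @pi_gt0 R.
by apply: sin_gt0_pi; rewrite mulr_gt0//= gtr_pMr.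
Qed.

Lemma is_derive_cot_reg x : 0 < x < 1 -> is_derive x 1 cot_reg
  (pi ^+ 2 / sin (pi * x) ^+ 2 - x ^- 2 - (1 - x) ^- 2).
Proof.
move=> x01; have /andP[x0 x1] := x01; have s0 := sin_pi_gt0 x01.
apply: is_derive_eq.
  apply: is_derive1B; first apply: is_derive1B.
  - by apply: (@is_derive1V _ id); rewrite ?gt_eqF.
  - apply: is_derive1V; first by rewrite gt_eqF// subr_gt0.
  - apply/is_derive1Zl/is_derive1M.
    by apply: is_derive1V; rewrite gt_eqF.
rewrite /GRing.scale /=.
have := cos2Dsin2 (pi * x); move: (sin _) (cos _) s0 => s c s0 E.
have -> : pi ^+ 2 / s ^+ 2 = pi ^+ 2 * (c ^+ 2 + s ^+ 2) / s ^+ 2 by rewrite E mulr1.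
by field; rewrite subr_eq0 !gt_eqF.
Qed.

(** The symmetry x -> 1 - x reduces to x <= 1/2, where the first two terms differ by at most pi^2
    and the third is at most 4. *)
Lemma cot_reg_derive_bound x : 0 < x < 1 ->
  `|pi ^+ 2 / sin (pi * x) ^+ 2 - x ^- 2 - (1 - x) ^- 2| <= pi ^+ 2 + 4.
Proof.
wlog x2 : x / x <= 1 / 2 => [H x01|/andP[x0 x1]].
  have [|x2] := leP x (1 / 2); first by move=> ?; exact: H.
  have := H (1 - x); rewrite subKr => H'.
  have -> : sin (pi * x) = sin (pi * (1 - x)).
    by rewrite mulrBr mulr1 sinB sinpi cospi mul0r mulN1r opprK add0r.
  by rewrite addrAC; apply: H'; lra.
have := @sin_pi_bounds x; rewrite x0 x2 => /(_ isT).
have y0 : 0 < 1 - x by lra.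
have : (1 - x) ^- 2 <= 4.
  rewrite -[4]invrK lef_pV2 ?posrE ?exprn_gt0 ?invr_gt0//.
  by rewrite expr2; nra.
have : 0 <= (1 - x) ^- 2 by rewrite invr_ge0 exprn_ge0// ltW.
have : 0 <= (pi : R) ^+ 2 by rewrite sqr_ge0.
by move=> ? ? ? /andP[? ?]; rewrite ler_norml; apply/andP; split; lra.
Qed.

Lemma cot_reg_lipschitz x y : 0 < x -> x <= y -> y < 1 ->
  `|cot_reg x - cot_reg y| <= (pi ^+ 2 + 4) * (y - x).
Proof.
move=> x0 xy y1; rewrite distrC.
have D z : x <= z <= y -> is_derive z 1 cot_reg
    (pi ^+ 2 / sin (pi * z) ^+ 2 - z ^- 2 - (1 - z) ^- 2).
  move=> /andP[? ?]; apply: is_derive_cot_reg.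
  by rewrite (lt_le_trans x0)//= (le_lt_trans _ y1).
have D' z : z \in `]x, y[%R -> is_derive z 1 cot_reg
    (pi ^+ 2 / sin (pi * z) ^+ 2 - z ^- 2 - (1 - z) ^- 2).
  by rewrite in_itv/= => /andP[? ?]; apply: D; rewrite !ltW.
have cf : {within `[x, y], continuous cot_reg}.
  apply: derivable_within_continuous => z; rewrite in_itv/= => /D ?.
  exact: ex_derive.
have [c] := MVT_segment xy D' cf.
rewrite in_itv/= => /andP[xc cy] ->; rewrite normrM [X in _ * X]ger0_norm ?subr_ge0//.
rewrite ler_wpM2r ?subr_ge0//; apply: cot_reg_derive_bound.
by rewrite (lt_le_trans x0)//= (le_lt_trans _ y1).
Qed.

(* Herglotz's trick in Lipschitz form: the functional equation halves any
   Lipschitz constant, so no continuity at the end points is needed. *)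
Lemma herglotz (h : R -> R) (L : R) :
  (forall x y, 0 < x < 1 -> 0 < y < 1 -> `|h x - h y| <= L * `|x - y|) ->
  (forall x, 0 < x < 1 -> h (x / 2) + h ((x + 1) / 2) = 2 * h x) ->
  forall x y, 0 < x < 1 -> 0 < y < 1 -> h x = h y.
Proof.
move=> hL h2 x y x01 y01; apply/eqP; rewrite -subr_eq0 -normr_eq0.
have hn n : forall x y, 0 < x < 1 -> 0 < y < 1 ->
    2 ^+ n * `|h x - h y| <= L * `|x - y|.
  elim: n => [|n ih] {x01 y01}x {}y x01 y01; first by rewrite mul1r hL.
  have i1 := ih (x / 2) (y / 2); have i2 := ih ((x + 1) / 2) ((y + 1) / 2).
  have e : h x - h y =
      ((h (x / 2) - h (y / 2)) + (h ((x + 1) / 2) - h ((y + 1) / 2))) / 2.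
    by have := h2 _ x01; have := h2 _ y01; lra.
  rewrite e normrM [`|2^-1|]gtr0_norm ?invr_gt0// exprS.
  have -> : forall u v : R, 2 * u * (v / 2) = u * v by move=> u v; field.
  apply: (@le_trans _ _ (L * `|x / 2 - y / 2| + L * `|(x + 1) / 2 - (y + 1) / 2|)).
    apply: (le_trans (ler_wpM2l _ (ler_normD _ _))); first by rewrite exprn_ge0.
    by rewrite mulrDr lerD// ?i1 ?i2//; lra.
  rewrite (_ : (x + 1) / 2 - (y + 1) / 2 = (x - y) / 2); last by lra.
  rewrite (_ : x / 2 - y / 2 = (x - y) / 2); last by lra.
  by rewrite normrM [`|2^-1|]gtr0_norm ?invr_gt0//; lra.
apply/negPn/negP => d0.
have {}d0 : 0 < `|h x - h y| by rewrite lt_neqAle eq_sym d0 normr_ge0.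
set M := L * `|x - y|.
have := hn (Num.Def.archi_bound (M / `|h x - h y|)) _ _ x01 y01.
rewrite -/M -ler_pdivlMr// leNgt => /negP; apply.
apply: (lt_le_trans (archi_boundP _)).
  by rewrite divr_ge0// (le_trans _ (hL _ _ x01 y01)).
by rewrite -natrX ler_nat ltnW// ltn_expl.
Qed.

Definition cot_defect x := ibeta_cst x - ibeta_cst (1 - x) -
  pi * (cos (pi * x) / sin (pi * x)).

(** Two recurrence steps at x and at 1 - x release 1/x - 1/(1-x), which combines with the cotangent
    into [cot_reg]. Every term on the right is then Lipschitz on the open unit interval. *)
Lemma cot_defectE x : 0 < x < 1 -> cot_defect x = cot_reg x +
  ((x + 1)^-1 - (2 - x)^-1) + (ibeta_cst (x + 2) - ibeta_cst (1 - x + 2)).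
Proof.
move=> /andP[x0 x1]; rewrite /cot_defect /cot_reg (ibeta_cstS2 x0).
rewrite (@ibeta_cstS2 R (1 - x)) ?subr_gt0// !div1r.
by rewrite (_ : 1 - x + 1 = 2 - x); [ring | lra].
Qed.

Lemma inv_lipschitz x y : 1 <= x -> 1 <= y -> `|x^-1 - y^-1| <= `|x - y|.
Proof.
move=> x1 y1; have x0 : 0 < x by lra.
have y0 : 0 < y by lra.
have -> : x^-1 - y^-1 = (y - x) / (x * y) by field; rewrite !gt_eqF.
rewrite normrM distrC ler_piMr// gtr0_norm ?invr_gt0 ?mulr_gt0//.
by rewrite invf_le1 ?mulr_gt0//; nra.
Qed.

(** The constant adds pi^2 + 4 for [cot_reg], 1 for each of the two reciprocals and 1 for each of
    the two values of [ibeta_cst]. *)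
Lemma cot_defect_lipschitz x y : 0 < x < 1 -> 0 < y < 1 ->
  `|cot_defect x - cot_defect y| <= (pi ^+ 2 + 8) * `|x - y|.
Proof.
wlog xy : x y / x <= y => [H x01 y01|x01 y01].
  have [/H|/ltW /H] := leP x y; first exact.
  by rewrite distrC [`|x - y|]distrC; exact.
have /andP[x0 x1] := x01; have /andP[y0 y1] := y01.
rewrite !cot_defectE//.
have h1 := cot_reg_lipschitz x0 xy y1.
have h2 : `|(x + 1)^-1 - (y + 1)^-1| <= y - x.
  by rewrite (le_trans (inv_lipschitz _ _))//; [lra|lra|rewrite ler0_norm; lra].
have h3 : `|(2 - x)^-1 - (2 - y)^-1| <= y - x.
  by rewrite (le_trans (inv_lipschitz _ _))//; [lra|lra|rewrite ger0_norm; lra].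
have h4 := ibeta_cst_lipschitz (ltW x0) xy.
have h5 : `|ibeta_cst (1 - y + 2) - ibeta_cst (1 - x + 2)| <= (1 - x) - (1 - y).
  by apply: ibeta_cst_lipschitz; lra.
rewrite [`|x - y|]ler0_norm; last by lra.
move: h1 h2 h3 h4 h5; rewrite !ler_norml.
by move=> /andP[? ?] /andP[? ?] /andP[? ?] /andP[? ?] /andP[? ?];
  apply/andP; split; lra.
Qed.

(** Duplication at x minus duplication at 1 - x cancels 2 ln 2. With theta = pi x / 2 the
    trigonometric part is cot theta - tan theta = 2 cot (2 theta). *)
Lemma cot_defect_duplication x : 0 < x < 1 ->
  cot_defect (x / 2) + cot_defect ((x + 1) / 2) = 2 * cot_defect x.
Proof.
move=> x01; have /andP[x0 x1] := x01; rewrite /cot_defect.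
have := ibeta_cst_duplication x0.
have := @ibeta_cst_duplication R (1 - x); rewrite subr_gt0 => /(_ x1).
rewrite (_ : (1 - x + 1) / 2 = 1 - x / 2); last by lra.
rewrite (_ : (1 - x) / 2 = 1 - (x + 1) / 2); last by lra.
have -> : pi * ((x + 1) / 2) = pi * (x / 2) + pi / 2 by lra.
rewrite sinDpihalf cosDpihalf (_ : pi * x = (pi * (x / 2)) *+ 2); last first.
  by rewrite -mulr_natr; lra.
rewrite sin_mulr2n cos_mulr2n -[_ ^+ 2 *+ 2 - 1](_ : cos (pi * (x / 2)) ^+ 2
  - sin (pi * (x / 2)) ^+ 2 = _); last first.
  by have := cos2Dsin2 (pi * (x / 2)); rewrite -mulr_natr; lra.
have s0 : 0 < sin (pi * (x / 2)) by apply: sin_pi_gt0; lra.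
have c0 : 0 < cos (pi * (x / 2)).
  by apply: cos_gt0_pihalf; have := @pi_gt0 R; nra.
move: (sin _) (cos _) s0 c0 => s c s0 c0 H1 H2.
have : c / s + - s / c = 2 * ((c ^+ 2 - s ^+ 2) / ((c * s) *+ 2)).
  by rewrite -mulr_natr; field; rewrite !gt_eqF.
by move=> /(congr1 ( *%R pi)) E; lra.
Qed.

Lemma ibeta_cst_reflection x : 0 < x < 1 ->
  ibeta_cst x - ibeta_cst (1 - x) = pi * (cos (pi * x) / sin (pi * x)).
Proof.
move=> x01; apply/eqP; rewrite -subr_eq0; apply/eqP.
have h12 : 0 < (1 / 2 : R) < 1 by lra.
rewrite -[LHS]/(cot_defect x).
rewrite (herglotz cot_defect_lipschitz cot_defect_duplication x01 h12).
rewrite /cot_defect div1r cos_pihalf mul0r mulr0 subr0.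
by rewrite (_ : 1 - 2^-1 = 2^-1) ?subrr//; lra.
Qed.

(** The left side is the integral of t^(x-1) / (1+t) over the positive half-line, split at t = 1
    with the outer part inverted. Duplication turns each part into half a difference of constants,
    and reflection at x/2 and (x+1)/2 yields pi (cot theta + tan theta) / 2 = pi / sin (2 theta)
    with theta = pi x / 2. *)
Lemma ibeta_cst_cosecant x : 0 < x < 1 ->
  ibeta_cst (x / 2) - ibeta_cst x - ln 2 +
  (ibeta_cst ((1 - x) / 2) - ibeta_cst (1 - x) - ln 2) = pi / sin (pi * x).
Proof.
move=> x01; have /andP[x0 x1] := x01.
have := ibeta_cst_duplication x0.
have := @ibeta_cst_duplication R (1 - x); rewrite subr_gt0 => /(_ x1).
have := @ibeta_cst_reflection (x / 2).
have := @ibeta_cst_reflection ((x + 1) / 2).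
rewrite (_ : (1 - x + 1) / 2 = 1 - x / 2); last by lra.
rewrite (_ : (1 - x) / 2 = 1 - (x + 1) / 2); last by lra.
have -> : pi * ((x + 1) / 2) = pi * (x / 2) + pi / 2 by lra.
rewrite sinDpihalf cosDpihalf (_ : pi * x = (pi * (x / 2)) *+ 2); last first.
  by rewrite -mulr_natr; lra.
rewrite sin_mulr2n.
have s0 : 0 < sin (pi * (x / 2)) by apply: sin_pi_gt0; lra.
have c0 : 0 < cos (pi * (x / 2)).
  by apply: cos_gt0_pihalf; have := @pi_gt0 R; nra.
have E := cos2Dsin2 (pi * (x / 2)).
move: (sin _) (cos _) s0 c0 E => s c s0 c0 E H1 H2 H3 H4.
have {}H1 := H1 ltac:(lra); have {}H2 := H2 ltac:(lra).
have -> : pi / ((c * s) *+ 2) = (pi * (c / s) - pi * (- s / c)) / 2.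
  have -> : pi / ((c * s) *+ 2) = pi * (c ^+ 2 + s ^+ 2) / ((c * s) *+ 2).
    by rewrite E mulr1.
  by rewrite -mulr_natr; field; rewrite !gt_eqF.
by lra.
Qed.

End cotangent.

(** * Integrable functions with a known integral *)

Lemma integrable_setU (d : measure_display) (T : measurableType d) (R : realType)
    (mu : {measure set T -> \bar R}) (A B : set T) (g : T -> \bar R) :
  measurable A -> measurable B -> [disjoint A & B] ->
  mu.-integrable A g -> mu.-integrable B g -> mu.-integrable (A `|` B) g.
Proof.
move=> mA mB AB /integrableP[mfA fA] /integrableP[mfB fB].
have mf : measurable_fun (A `|` B) g by apply/measurable_funU.
apply/integrableP; split => //.
rewrite ge0_integral_setU//; first exact: lte_add_pinfty.
exact: measurableT_comp.
Qed.

Section has_integral.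
Context {R : realType}.
Implicit Types (D A B : set R) (f g : R -> R).
Notation mu := (@lebesgue_measure R).

(** Integrability is bundled with the value because [Rintegral] returns a real number even when the
    function is not integrable, and [is_hilbert] asks for both. *)
Definition has_integral D f (v : R) :=
  mu.-integrable D (EFin \o f) /\ Rintegral mu D f = v.

Lemma has_integral_eq D f g v : measurable D -> (forall x, D x -> f x = g x) ->
  has_integral D f v -> has_integral D g v.
Proof.
move=> mD fg [fi <-]; have fg' : {in D, f =1 g} by move=> x /set_mem /fg.
split; last by apply: eq_Rintegral => x xD; rewrite fg'.
by apply: eq_integrable fi => // x /fg' /= ->.
Qed.

Lemma has_integralZl D f v k : measurable D ->
  has_integral D f v -> has_integral D (fun x => k * f x) (k * v).
Proof.
move=> mD [fi <-]; split; last by rewrite RintegralZl.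
exact: integrableZl fi.
Qed.

Lemma has_integralU A B f v w : measurable A -> measurable B -> [disjoint A & B] ->
  has_integral A f v -> has_integral B f w -> has_integral (A `|` B) f (v + w).
Proof.
move=> mA mB AB [fA <-] [fB <-].
have fAB : mu.-integrable (A `|` B) (EFin \o f) by exact: integrable_setU.
by split => //; rewrite Rintegral_setU.
Qed.

Lemma has_integral0 D f : measurable D -> (forall x, D x -> f x = 0) ->
  has_integral D f 0.
Proof.
move=> mD f0; apply: (@has_integral_eq _ (cst 0)) => // [x /f0 ->//|].
split; first exact: integrable0.
by rewrite Rintegral_cst// mul0r.
Qed.

Lemma has_integral_set1 a f : has_integral [set a] f 0.
Proof.
split; last exact: Rintegral_set1.
apply/integrableP; split; first exact: measurable_fun_set1.
by rewrite integral_set1 ltry.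
Qed.

Lemma ge0_has_integral D f v : measurable D -> measurable_fun D f ->
  (forall x, D x -> 0 <= f x) -> (\int[mu]_(x in D) (f x)%:E = v%:E)%E ->
  has_integral D f v.
Proof.
move=> mD mf f0 fv; split; last by rewrite /Rintegral fv.
apply/integrableP; split; first exact/measurable_EFinP.
rewrite (_ : integral _ _ _ = v%:E) ?ltry// -fv.
by apply: eq_integral => x /set_mem /f0 fx /=; rewrite ger0_norm.
Qed.

End has_integral.

(** * Fundamental theorem of calculus for improper integrals of nonnegative functions *)

Section improper_FTC.
Context {R : realType}.
Implicit Types (f F : R -> R).
Notation mu := (@lebesgue_measure R).

(** The usual theorem applies on each compact interval; monotone convergence gives the limit of the
    integrals, and the limits of F give the right side. Thus f may blow up at the ends of the
    union. *)
Lemma ge0_FTC_exhaustion f F (u v : R^nat) (l L : R) :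
  nonincreasing_seq u -> nondecreasing_seq v -> (forall n, u n < v n) ->
  (forall n x, u n <= x <= v n ->
     [/\ is_derive x 1 F (f x), {for x, continuous f} & 0 <= f x]) ->
  F (u n) @[n --> \oo] --> l -> F (v n) @[n --> \oo] --> L ->
  (\int[mu]_(x in \bigcup_n `[u n, v n]%classic) (f x)%:E = (L - l)%:E)%E.
Proof.
move=> du iv uv H Fl FL.
have cf n : {within `[u n, v n], continuous f}.
  apply: continuous_in_subspaceT => x /set_mem; rewrite /= in_itv/=.
  by case/(H n).
have mf n : measurable_fun `[u n, v n]%classic (EFin \o f).
  by apply/measurable_EFinP; apply: subspace_continuous_measurable_fun => //; exact: cf.
have nd : nondecreasing_seq (fun n => `[u n, v n]%classic : set R).
  move=> m n mn; rewrite subsetEset; apply: subset_itv; rewrite bnd_simp.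
    exact: du.
  exact: iv.
have c1 : (\int[mu]_(x in `[u n, v n]) (f x)%:E)%E @[n --> \oo] -->
    (\int[mu]_(x in \bigcup_n `[u n, v n]%classic) (f x)%:E)%E.
  apply: ge0_nondecreasing_set_cvg_integral => // n x.
  by rewrite /= in_itv/= => /(H n)[]; rewrite lee_fin.
have c2 : (F (v n) - F (u n))%:E @[n --> \oo] --> (L - l)%:E.
  by apply: cvg_EFin; [exact: nearW | apply: cvgB].
apply: (cvg_unique _ c1) => //; apply: cvg_trans c2; apply: near_eq_cvg; apply: nearW => n.
rewrite (@continuous_FTC2 _ f F (u n) (v n))//.
  split.
  - move=> x; rewrite in_itv/= => /andP[/ltW ux /ltW xv].
    by have [//|? _ _] := H n x; rewrite ?ux//; exact: ex_derive.
  - apply: cvg_at_right_filter.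
    have [|? _ _] := H n (u n); first by rewrite lexx ltW.
    exact: is_derive1_continuous.
  - apply: cvg_at_left_filter.
    have [|? _ _] := H n (v n); first by rewrite lexx ltW.
    exact: is_derive1_continuous.
move=> x; rewrite in_itv/= => /andP[/ltW ux /ltW xv].
have [|? _ _] := H n x; first by rewrite ux.
exact: is_derive1_derive1.
Qed.

(** The quarter in [d] keeps the two margins together at most half the length, so the interval is
    nondegenerate already at n = 0. *)
Lemma bigcup_itv_oo (a b : R) (d := (b - a) / 4) : a < b ->
  \bigcup_n `[a + d / n.+1%:R, b - d / n.+1%:R]%classic = `]a, b[%classic.
Proof.
move=> ab; have d0 : 0 < d by rewrite divr_gt0 ?subr_gt0.
apply/seteqP; split => x /=.
  move=> [n _]; rewrite /= !in_itv/= => /andP[h1 h2].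
  have dn : 0 < d / n.+1%:R by rewrite divr_gt0.
  by rewrite (lt_le_trans _ h1) ?(le_lt_trans h2) ?ltrDl ?gtrBl.
rewrite in_itv/= => /andP[ax xb].
set e := Num.min (x - a) (b - x).
have e0 : 0 < e by rewrite lt_min !subr_gt0 ax.
exists (Num.Def.archi_bound (d / e)) => //=.
have : d / (Num.Def.archi_bound (d / e)).+1%:R <= e.
  rewrite ler_pdivrMr// mulrC -ler_pdivrMr// ltW//.
  apply: (lt_trans (archi_boundP _)); first by rewrite divr_ge0 ?ltW.
  by rewrite ltr_nat.
by rewrite le_min in_itv/=; move: (d / _) => q /andP[? ?]; apply/andP; split; lra.
Qed.

Lemma ge0_FTC_oo f F (a b l L : R) : a < b ->
  (forall x, a < x < b ->
     [/\ is_derive x 1 F (f x), {for x, continuous f} & 0 <= f x]) ->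
  F x @[x --> a^'+] --> l -> F x @[x --> b^'-] --> L ->
  has_integral `]a, b[ f (L - l).
Proof.
move=> ab H Fl FL; apply: ge0_has_integral => //.
- apply: open_continuous_measurable_fun => // x /set_mem.
  by rewrite /= in_itv/= => /H[].
- by move=> x; rewrite /= in_itv/= => /H[].
pose d := (b - a) / 4.
have d0 : 0 < d by rewrite divr_gt0 ?subr_gt0.
have dn n : 0 < d / n.+1%:R by rewrite divr_gt0.
have dn1 n : d / n.+1%:R <= d by rewrite ler_piMr ?(ltW d0)// invf_le1// ler1n.
have dc : d / n.+1%:R @[n --> \oo] --> 0.
  rewrite -[X in _ --> X](mulr0 d); apply: cvgM; first exact: cvg_cst.
  exact: cvg_harmonic.
have dd m n : (m <= n)%N -> d / n.+1%:R <= d / m.+1%:R.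
  by move=> mn; rewrite ler_pM2l// lef_pV2 ?posrE// ler_nat.
rewrite -(bigcup_itv_oo ab).
apply: (@ge0_FTC_exhaustion f F).
- by move=> m n mn; rewrite lerD2l dd.
- by move=> m n mn; rewrite lerD2l lerN2 dd.
- by move=> n; rewrite -/d; have := dn1 n; move: (d / _) => q; rewrite /d; lra.
- move=> n x; rewrite -/d => xn; apply: H; move: xn (dn n); move: (d / _) => q.
  by move=> /andP[? ?] ?; apply/andP; split; lra.
- move/cvg_at_rightP : Fl; apply; split; first by move=> n; rewrite ltrDl.
  by rewrite -[X in _ --> X]addr0; apply: cvgD => //; exact: cvg_cst.
- move/cvg_at_leftP : FL; apply; split; first by move=> n; rewrite gtrBl.
  by rewrite -[X in _ --> X]subr0; apply: cvgB => //; exact: cvg_cst.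
Qed.

(** The upper end uses n + 2 so that the interval is nondegenerate at n = 0, where the lower margin
    is 1. *)
Lemma bigcup_itv_oy (a : R) :
  \bigcup_n `[a + n.+1%:R^-1, a + n.+2%:R]%classic = `]a, +oo[%classic.
Proof.
apply/seteqP; split => x /=.
  move=> [n _]; rewrite /= !in_itv/= andbT => /andP[h1 _].
  by rewrite (lt_le_trans _ h1)// ltrDl.
rewrite in_itv/= andbT => ax.
pose N := (Num.Def.archi_bound (x - a) + Num.Def.archi_bound (x - a)^-1)%N.
have x0 : 0 < x - a by rewrite subr_gt0.
exists N => //=; rewrite in_itv/=; apply/andP; split.
  rewrite -lerBrDl -[leRHS]invrK lef_pV2 ?posrE ?invr_gt0//.
  apply: ltW; apply: (lt_le_trans (archi_boundP _)); first by rewrite invr_ge0 ltW.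
  by rewrite ler_nat /N leqW// leq_addl.
rewrite -lerBlDl; apply: ltW; apply: (lt_le_trans (archi_boundP _)); first exact: ltW.
by rewrite ler_nat /N 2?leqW// leq_addr.
Qed.

Lemma ge0_FTC_oy f F (a l L : R) :
  (forall x, a < x ->
     [/\ is_derive x 1 F (f x), {for x, continuous f} & 0 <= f x]) ->
  F x @[x --> a^'+] --> l -> F x @[x --> +oo] --> L ->
  has_integral `]a, +oo[ f (L - l).
Proof.
move=> H Fl FL; apply: ge0_has_integral => //.
- apply: open_continuous_measurable_fun => // x /set_mem.
  by rewrite /= in_itv/= andbT => /H[].
- by move=> x; rewrite /= in_itv/= andbT => /H[].
rewrite -bigcup_itv_oy; apply: (@ge0_FTC_exhaustion f F).
- by move=> m n mn; rewrite lerD2l lef_pV2 ?posrE// ler_nat.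
- by move=> m n mn; rewrite lerD2l ler_nat.
- move=> n; rewrite ltrD2l (@le_lt_trans _ _ 1)// ?ltr1n//.
  by rewrite invf_le1// ler1n.
- by move=> n x /andP[h _]; apply: H; rewrite (lt_le_trans _ h)// ltrDl.
- move/cvg_at_rightP : Fl; apply; split; first by move=> n; rewrite ltrDl.
  rewrite -[X in _ --> X]addr0; apply: cvgD; first exact: cvg_cst.
  exact: cvg_harmonic.
- move/cvg_pinftyP : FL; apply; apply/cvgryPge => r.
  near=> n; rewrite -lerBlDl; apply: (@le_trans _ _ n%:R); last by rewrite ler_nat leqW.
  by near: n; exact: nbhs_infty_ger.
Unshelve. all: by end_near. Qed.

End improper_FTC.

(** * Affine and inverse changes of variable against a power *)

Section power_weight.
Context {R : realType}.
Implicit Types (w F : R -> R) (m s r l y : R).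

Lemma is_derive_scale s y : is_derive y 1 (fun y => (y - 1) / s) s^-1.
Proof.
have -> : (fun y : R => (y - 1) / s) = (fun y => s^-1 * y + - s^-1).
  by apply/funext => z; ring.
exact: is_derive1_affine.
Qed.

Lemma is_derive_subr1 y : is_derive y 1 (fun y => y - 1) 1.
Proof. by have := is_derive_scale 1 y; under eq_fun do rewrite divr1; rewrite invr1. Qed.

Lemma is_derive_scaleV s y : 1 < y ->
  is_derive y 1 (fun y => s / (y - 1)) (- (s / (y - 1) ^+ 2)).
Proof.
move=> y1; apply: is_derive_eq.
  apply: is_derive1Zl; apply: is_derive1V (is_derive_subr1 y).
  by rewrite gt_eqF// subr_gt0.
by rewrite mulN1r mulrN.
Qed.

Lemma is_derive_powR_shift m y : 1 < y ->
  is_derive y 1 (fun y => (y - 1) `^ m) (m * (y - 1) `^ (m - 1)).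
Proof.
move=> y1; apply: is_derive_eq.
  apply: (@is_derive1_chain _ (fun x => x `^ m)) (is_derive_subr1 y).
  by apply: is_derive1_powR; rewrite subr_gt0.
by rewrite mulr1.
Qed.

(** Substitution t = (y-1)/s. The weight w stays abstract because, with s = |X - 1|, the kernel
    leads to 1/(1-t) for X > 1 and to 1/(1+t) for X < 1; r marks the end of the piece. *)
Lemma has_integral_scale w F m s r l : 0 < s -> 0 < r ->
  (forall t, 0 < t < r -> is_derive t 1 F (t `^ (- m) * w t)) ->
  (forall t, 0 < t < r -> derivable w t 1 /\ 0 <= w t) ->
  F t @[t --> 0^'+] --> 0 -> F t @[t --> r^'-] --> l ->
  has_integral `]1, 1 + s * r[ (fun y => (y - 1) `^ (- m) * (w ((y - 1) / s) / s))
    (s `^ (- m) * l).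
Proof.
move=> s0 r0 dF Hw F0 Fl.
have tr y : 1 < y < 1 + s * r -> 0 < (y - 1) / s < r.
  move=> /andP[y1 yr]; rewrite divr_gt0 ?subr_gt0//= ltr_pdivrMr//.
  by rewrite ltrBlDl mulrC.
rewrite -[X in has_integral _ _ X]subr0 -[X in _ - X](mulr0 (s `^ (- m))).
apply: (@ge0_FTC_oo _ _ (fun y => s `^ (- m) * F ((y - 1) / s))).
- by rewrite ltrDl mulr_gt0.
- move=> y yr; have t0 := tr _ yr; have /andP[y1 _] := yr.
  have [/derivableP dw w0] := Hw _ t0.
  have z0 : 0 < y - 1 by rewrite subr_gt0.
  split.
  + apply: is_derive_eq.
      apply: is_derive1Zl; apply: (@is_derive1_chain _ F) (is_derive_scale s y).
      exact: dF.
    have e : (y - 1) `^ (- m) = s `^ (- m) * ((y - 1) / s) `^ (- m).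
      by rewrite -powRM ?(ltW s0) ?divr_ge0 ?(ltW z0) ?(ltW s0)// mulrC divfK ?gt_eqF.
    by rewrite e; ring.
  + exact: is_derive1_continuous (is_derive1M (is_derive_powR_shift (- m) y1)
      (is_derive1M (@is_derive1_chain _ w (fun y => (y - 1) / s) _ _ _ dw
        (is_derive_scale s y)) (is_derive_cst s^-1 y 1))).
  + by rewrite mulr_ge0 ?powR_ge0// divr_ge0// ltW.
- apply: cvgM; first exact: cvg_cst.
  apply: cvg_comp_at_right F0.
    have := is_derive1_continuous (is_derive_scale s 1).
    by rewrite /prop_for /continuous_at subrr mul0r => h; exact: cvg_at_right_filter.
  by near=> y; rewrite divr_gt0// subr_gt0.
- apply: cvgM; first exact: cvg_cst.
  apply: cvg_comp_at_left Fl.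
    have := is_derive1_continuous (is_derive_scale s (1 + s * r)).
    rewrite /prop_for /continuous_at addrAC subrr add0r mulrAC divff ?gt_eqF// mul1r => h.
    exact: cvg_at_left_filter.
  near=> y; rewrite ltr_pdivrMr// ltrBlDl mulrC.
  by near: y; exact: nbhs_left_lt.
Unshelve. all: by end_near. Qed.

(** Substitution t = s/(y-1), for which dy/(y-1) = - dt/t: the exponent -m becomes m - 1 and the
    half-line becomes bounded. The orientation is reversed, hence the minus sign in the
    primitive. *)
Lemma has_integral_scaleV w F m s r l : 0 < s -> 0 < r ->
  (forall t, 0 < t < r -> is_derive t 1 F (t `^ (m - 1) * w t)) ->
  (forall t, 0 < t < r -> derivable w t 1 /\ 0 <= w t) ->
  F t @[t --> 0^'+] --> 0 -> F t @[t --> r^'-] --> l ->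
  has_integral `]1 + s / r, +oo[
    (fun y => (y - 1) `^ (- m) * (w (s / (y - 1)) / (y - 1))) (s `^ (- m) * l).
Proof.
move=> s0 r0 dF Hw F0 Fl.
have a1 y : 1 + s / r < y -> 1 < y.
  by apply: le_lt_trans; rewrite lerDl divr_ge0// ltW.
have tr y : 1 + s / r < y -> 0 < s / (y - 1) < r.
  move=> yr; have y1 := a1 _ yr; have z0 : 0 < y - 1 by rewrite subr_gt0.
  rewrite divr_gt0//= ltr_pdivrMr// mulrC -ltr_pdivrMr// ltrBrDl//.
rewrite (_ : s `^ (- m) * l = - (s `^ (- m) * 0) - - (s `^ (- m) * l)); last by ring.
apply: (@ge0_FTC_oy _ _ (fun y => - (s `^ (- m) * F (s / (y - 1))))).
- move=> y yr; have t0 := tr _ yr; have y1 := a1 _ yr.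
  have [/derivableP dw w0] := Hw _ t0.
  have z0 : 0 < y - 1 by rewrite subr_gt0.
  split.
  + apply: is_derive_eq.
      apply: is_deriveN; apply: is_derive1Zl.
      apply: (@is_derive1_chain _ F) (is_derive_scaleV s y1).
      exact: dF.
    rewrite powRB ?(gt_eqF (andP t0).1) ?implybT// powRr1; last first.
      by rewrite ltW//; case/andP: t0.
    have e : s `^ (- m) * (s / (y - 1)) `^ m = (y - 1) `^ (- m).
      rewrite powRM ?(ltW s0) ?invr_ge0 ?(ltW z0)// mulrA -powRD ?(gt_eqF s0) ?implybT//.
      by rewrite addrC subrr powRr0 mul1r powRN -powR_inv1 ?(ltW z0)// -powRrM mulN1r powRN.
    by rewrite -e; field; rewrite !gt_eqF.
  + exact: is_derive1_continuous (is_derive1M (is_derive_powR_shift (- m) y1)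
      (is_derive1M (@is_derive1_chain _ w (fun y => s / (y - 1)) _ _ _ dw
        (is_derive_scaleV s y1))
        (@is_derive1V _ (fun y => y - 1) _ _ (lt0r_neq0 z0) (is_derive_subr1 y)))).
  + by rewrite mulr_ge0 ?powR_ge0// divr_ge0// ltW.
- apply: cvgN; apply: cvgM; first exact: cvg_cst.
  apply: cvg_comp_at_left Fl.
    have y1 : 1 < 1 + s / r by rewrite ltrDl divr_gt0.
    have := is_derive1_continuous (is_derive_scaleV s y1).
    rewrite /prop_for /continuous_at.
    rewrite (_ : s / (1 + s / r - 1) = r) => [h|]; first exact: cvg_at_right_filter.
    by rewrite addrAC subrr add0r invf_div mulrC divfK ?gt_eqF.
  near=> y.
  have yr : 1 + s / r < y by near: y; exact: nbhs_right_gt.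
  by case/andP: (tr _ yr).
- apply: cvgN; apply: cvgM; first exact: cvg_cst.
  apply: cvg_comp_at_right F0; last first.
    near=> y; rewrite divr_gt0// subr_gt0.
    by near: y; exact: (nbhs_pinfty_gt (num_real _)).
  rewrite -[X in _ --> X](mulr0 s); apply: cvgM; first exact: cvg_cst.
  apply/(@gtr0_cvgV0 _ _ _ _ (fun y : R => y - 1)).
    by near=> y; rewrite subr_gt0; near: y; exact: (nbhs_pinfty_gt (num_real _)).
  apply/cvgryPge => B; near=> y; rewrite lerBrDl.
  by near: y; exact: (nbhs_pinfty_ge (num_real _)).
Unshelve. all: by end_near. Qed.

End power_weight.

(** * Hilbert transform of a one-sided power *)

Section hilbert_power.
Context {R : realType}.
Variables (m : R) (f : R -> R).
Hypothesis m01 : 0 < m < 1.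
Hypothesis f_le1 : forall y, y <= 1 -> f y = 0.
Hypothesis f_gt1 : forall y, 1 < y -> f y = - sin (pi * m) * (y - 1) `^ (- m).
Notation mu := (@lebesgue_measure R).

Let m0 : 0 < m. Proof. by case/andP: m01. Qed.
Let m1 : 0 < 1 - m. Proof. by case/andP: m01; rewrite subr_gt0. Qed.

Lemma truncation_setE (X eps : R) : 0 < eps ->
  [set y : R | eps < `|X - y|] = `]-oo, X - eps[%classic `|` `]X + eps, +oo[%classic.
Proof.
move=> e0; apply/seteqP; split => y /=; rewrite !in_itv/= andbT.
  by rewrite lter_normr => /orP[h|h]; [left|right]; lra.
by rewrite lter_normr => -[h|h]; apply/orP; [left|right]; lra.
Qed.

Lemma truncation_set_measurable (X eps : R) : 0 < eps ->
  measurable [set y : R | eps < `|X - y|].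
Proof. by move=> e0; rewrite truncation_setE//; exact: measurableU. Qed.

Lemma is_derive_1B (t : R) : is_derive t 1 (fun t => 1 - t) (- 1).
Proof.
by apply: is_derive_eq (is_derive1B (is_derive_cst _ _ _) (is_derive_id _ _)) _; rewrite sub0r.
Qed.

Lemma is_derive_1BV (t : R) : t < 1 -> is_derive t 1 (fun t => (1 - t)^-1) ((1 - t) ^- 2).
Proof.
move=> t1; apply: is_derive_eq.
  apply: (@is_derive1V _ (fun t => 1 - t) _ _ _ (is_derive_1B t)).
  by rewrite gt_eqF// subr_gt0.
by rewrite opprK div1r.
Qed.

Lemma is_derive_1DV (t : R) : -1 < t -> is_derive t 1 (fun t => (1 + t)^-1) (- (1 + t) ^- 2).
Proof.
move=> t1.
have D : is_derive t 1 (fun t => 1 + t) 1.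
  by apply: is_derive_eq (is_derive1D (is_derive_cst _ _ _) (is_derive_id _ _)) _; rewrite add0r.
apply: is_derive_eq.
  by apply: (@is_derive1V _ (fun t => 1 + t) _ _ _ D); rewrite gt_eqF//; lra.
by rewrite mulN1r.
Qed.

Lemma ibeta_continuous_left a (r : R) : 0 < a -> 0 < r < 1 ->
  ibeta a t @[t --> r^'-] --> ibeta a r.
Proof.
move=> a0 r01; apply: cvg_at_left_filter.
exact: is_derive1_continuous (is_derive_ibeta a0 r01).
Qed.

(** The integrand vanishes below 1. On ]1, X - eps[ the kernel is 1/(s (1-t)) with t = (y-1)/s;
    beyond X + eps it is - 1/((y-1)(1-t)) with t = s/(y-1). The opposite signs produce the
    difference of two [ibeta] values. *)
Lemma has_integral_trunc (X eps : R) : 1 < X -> 0 < eps < X - 1 ->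
  let s := X - 1 in
  has_integral [set y : R | eps < `|X - y|] (fun y => f y / (X - y))
    (sin (pi * m) * (s `^ (- m) * ibeta m (s / (s + eps))) -
     sin (pi * m) * (s `^ (- m) * ibeta (1 - m) ((s - eps) / s))).
Proof.
move=> X1 /andP[e0 es] s; have s0 : 0 < s by rewrite subr_gt0.
have XE : X = 1 + s by rewrite /s; lra.
rewrite -/s in es; clearbody s; subst X.
have r1 : 0 < (s - eps) / s < 1.
  by rewrite divr_gt0//= ?subr_gt0// ltr_pdivrMr// mul1r gtrBl.
have r2 : 0 < s / (s + eps) < 1.
  by rewrite divr_gt0 ?addr_gt0//= ltr_pdivrMr ?addr_gt0// mul1r ltrDl.
have Dw (r t : R) : r < 1 -> 0 < t < r -> 
    derivable (fun t : R => (1 - t)^-1) t 1 /\ 0 <= (1 - t)^-1.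
  move=> r1' /andP[t0 tr]; have t1 := lt_trans tr r1'; split.
    by have ? := is_derive_1BV t1; exact: ex_derive.
  by rewrite invr_ge0 subr_ge0 ltW.
have I1 : has_integral `]-oo, 1] (fun y => f y / (1 + s - y)) 0.
  by apply: has_integral0 => // y; rewrite /= in_itv/= => /f_le1 ->; rewrite mul0r.
have I2 : has_integral `]1, 1 + s * ((s - eps) / s)[ (fun y => f y / (1 + s - y))
    (- sin (pi * m) * (s `^ (- m) * ibeta (1 - m) ((s - eps) / s))).
  have /andP[r10 r11] := r1.
  have h := @has_integral_scale R (fun t => (1 - t)^-1) (ibeta (1 - m)) m s _ _ s0 r10 _
    (fun t => Dw _ t r11) (ibeta_cvg0 m1) (ibeta_continuous_left m1 r1).
  apply: has_integral_eq (has_integralZl _ _ (h _)) => //.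
  - move=> y; rewrite /= in_itv/= => /andP[y1 ys].
    rewrite f_gt1// mulrA; congr (_ * _).
    move: ys; rewrite mulrC divfK ?gt_eqF// => ys.
    by field; rewrite ?andbT ?subr_eq0 !gt_eqF//; lra.
  - move=> t /andP[t0 tr]; have t01 : 0 < t < 1 by rewrite t0 (lt_trans tr).
    have -> : t `^ (- m) = t `^ (1 - m - 1) by congr (_ `^ _); lra.
    exact: is_derive_ibeta.
have I3 : has_integral `]1 + s / (s / (s + eps)), +oo[ (fun y => f y / (1 + s - y))
    (sin (pi * m) * (s `^ (- m) * ibeta m (s / (s + eps)))).
  have /andP[r20 r21] := r2.
  have h := @has_integral_scaleV R (fun t => (1 - t)^-1) (ibeta m) m s _ _ s0 r20 _
    (fun t => Dw _ t r21) (ibeta_cvg0 m0) (ibeta_continuous_left m0 r2).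
  apply: has_integral_eq (has_integralZl _ _ (h _)) => //.
  - move=> y; rewrite /= in_itv/= andbT => ys.
    have {}ys : 1 + s + eps < y.
      by move: ys; rewrite invf_div mulrC divfK ?gt_eqF//; lra.
    have y1 : 1 < y by lra.
    rewrite f_gt1//; move: (sin _) (_ `^ _) => S P.
    by field; apply/and3P; split; [rewrite lt_eqF | rewrite gt_eqF | rewrite gt_eqF]; lra.
  - move=> t /andP[t0 tr]; have t01 : 0 < t < 1 by rewrite t0 (lt_trans tr).
    exact: is_derive_ibeta.
have e1 : 1 + s * ((s - eps) / s) = 1 + s - eps by rewrite mulrC divfK ?gt_eqF//; lra.
have e2 : 1 + s / (s / (s + eps)) = 1 + s + eps.
  by rewrite invf_div mulrC divfK ?gt_eqF//; lra.
rewrite (_ : [set y | _] = `]-oo, 1]%classic `|` `]1, 1 + s * ((s - eps) / s)[%classic `|`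
    `]1 + s / (s / (s + eps)), +oo[%classic).
  rewrite [X in has_integral _ _ X](_ : _ = 0 + - sin (pi * m) * (s `^ (- m) * ibeta (1 - m) ((s - eps) / s))
    + sin (pi * m) * (s `^ (- m) * ibeta m (s / (s + eps)))); last by ring.
  apply: has_integralU I3 => //; first exact: measurableU.
  - by apply/disj_setPS => y /= [[|]]; rewrite !in_itv/= ?andbT ?e1 ?e2; lra.
  - apply: has_integralU I2 => //.
    by apply/disj_setPS => y /= []; rewrite !in_itv/=; lra.
rewrite truncation_setE// e1 e2; congr (_ `|` _).
apply/seteqP; split => y /=; rewrite !in_itv/=.
  by move=> yX; have [y1|y1] := leP y 1; [left|right].
by move=> [|]; lra.
Qed.

(** Since 1 - s/(s+eps) = eps/(s+eps) and 1 - (s-eps)/s = eps/s, the renormalising logarithms share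
    ln eps and differ by ln s - ln (s+eps), which tends to 0. *)
Lemma ibeta_trunc_cvg (s : R) : 0 < s ->
  (ibeta m (s / (s + eps)) - ibeta (1 - m) ((s - eps) / s)) @[eps --> 0^'+] -->
  pi * (cos (pi * m) / sin (pi * m)).
Proof.
move=> s0; rewrite -ibeta_cst_reflection// -[X in _ --> X]subr0.
have id0 : (eps : R) @[eps --> 0^'+] --> 0 by apply: cvg_at_right_filter; exact: cvg_id.
have csts : cst s eps @[eps --> (0 : R)^'+] --> s by exact: cvg_cst.
have se : s + eps @[eps --> 0^'+] --> s.
  by rewrite -[X in _ --> X]addr0; exact: cvgD.
have c1 : (ibeta m (s / (s + eps)) + ln (1 - s / (s + eps))) @[eps --> 0^'+] --> ibeta_cst m.
  apply: (@cvg_comp_at_left _ _ _ _ (fun eps => s / (s + eps))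
    (fun x => ibeta m x + ln (1 - x)) 1) (ibeta_cst_cvg m0).
    rewrite -[X in _ --> X](divff (lt0r_neq0 s0)).
    by apply: cvgM => //; apply: cvgV => //; rewrite gt_eqF.
  near=> eps; have e0 : 0 < eps by [].
  by rewrite ltr_pdivrMr ?addr_gt0// mul1r ltrDl.
have c2 : (ibeta (1 - m) ((s - eps) / s) + ln (1 - (s - eps) / s)) @[eps --> 0^'+] -->
    ibeta_cst (1 - m).
  apply: (@cvg_comp_at_left _ _ _ _ (fun eps => (s - eps) / s)
    (fun x => ibeta (1 - m) x + ln (1 - x)) 1) (ibeta_cst_cvg m1).
    have : (s - eps) / s @[eps --> 0^'+] --> (s - 0) / s.
      by apply: cvgM; [exact: cvgB | exact: cvg_cst].
    by rewrite subr0 divff ?gt_eqF.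
  near=> eps; have e0 : 0 < eps by [].
  by rewrite ltr_pdivrMr// mul1r gtrBl.
have c3 : (ln s - ln (s + eps)) @[eps --> 0^'+] --> 0.
  rewrite -[X in _ --> X](subrr (ln s)); apply: cvgB; first exact: cvg_cst.
  by apply: continuous_cvg => //; exact: continuous_ln.
have : (ibeta m (s / (s + eps)) + ln (1 - s / (s + eps)) -
    (ibeta (1 - m) ((s - eps) / s) + ln (1 - (s - eps) / s)) -
    (ln s - ln (s + eps))) @[eps --> 0^'+] --> ibeta_cst m - ibeta_cst (1 - m) - 0.
  by apply: cvgB c3; exact: cvgB c1 c2.
apply: cvg_trans; apply: near_eq_cvg; near=> eps.
have e0 : 0 < eps by [].
have -> : 1 - s / (s + eps) = eps / (s + eps).
  by field; rewrite gt_eqF// addr_gt0.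
have -> : 1 - (s - eps) / s = eps / s by field; rewrite gt_eqF.
by rewrite !ln_div ?posrE ?addr_gt0//; lra.
Unshelve. all: by end_near. Qed.

Lemma is_hilbert_gt1 (X : R) : 1 < X ->
  is_hilbert f X (cos (pi * m) / (X - 1) `^ m).
Proof.
move=> X1; have s0 : 0 < X - 1 by rewrite subr_gt0.
have S0 := sin_pi_gt0 m01.
split.
  (* The explicit integral requires a radius below X - 1; shrinking the radius enlarges the domain,
     and integrability restricts to the original one. *)
  move=> eps e0; pose e := Num.min eps ((X - 1) / 2).
  have ee : 0 < e < X - 1.
    rewrite lt_min e0 divr_gt0//= gt_min; apply/orP; right; lra.
  have e0' : 0 < e by case/andP: ee.
  apply: (integrableS _ _ _ (has_integral_trunc X1 ee).1).
  - exact: truncation_set_measurable.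
  - exact: truncation_set_measurable.
  - by move=> y /=; apply: le_lt_trans; rewrite ge_min lexx.
have -> : cos (pi * m) / (X - 1) `^ m =
    pi^-1 * (sin (pi * m) * (X - 1) `^ (- m) * (pi * (cos (pi * m) / sin (pi * m)))).
  have p0 := @pi_gt0 R; have P0 := powR_gt0 m s0; rewrite powRN.
  move: (sin _) (cos _) (_ `^ m) S0 P0 p0 => S C P S0 P0; move: pi => p p0.
  by field; rewrite !gt_eqF.
have : pi^-1 * (sin (pi * m) * (X - 1) `^ (- m) *
    (ibeta m ((X - 1) / (X - 1 + eps)) - ibeta (1 - m) ((X - 1 - eps) / (X - 1))))
    @[eps --> 0^'+] --> pi^-1 * (sin (pi * m) * (X - 1) `^ (- m) *
    (pi * (cos (pi * m) / sin (pi * m)))).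
  apply: cvgM; first exact: cvg_cst.
  by apply: cvgM; [exact: cvg_cst | exact: ibeta_trunc_cvg].
apply: cvg_trans; apply: near_eq_cvg; near=> eps.
rewrite /hilbert_trunc; congr (_ * _).
rewrite (has_integral_trunc X1 _).2; first by ring.
apply/andP; split => //; near: eps; exact: nbhs_right_lt.
Unshelve. all: by end_near. Qed.

Lemma is_derive_ibeta_alt a (t : R) : 0 < a -> 0 < t < 1 ->
  is_derive t 1 (fun t => ibeta (a / 2) (t ^+ 2) - ibeta a t) (t `^ (a - 1) * (1 + t)^-1).
Proof.
move=> a0 t01; have /andP[t0 t1] := t01; apply: is_derive_eq.
  apply: is_derive1B; first exact: is_derive_ibeta_sqr.
  exact: is_derive_ibeta.
rewrite (_ : 1 - t ^+ 2 = (1 - t) * (1 + t)); last by ring.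
by field; rewrite subr_eq0 !gt_eqF// addr_gt0.
Qed.

Lemma ibeta_alt_cvg0 (a : R) : 0 < a ->
  (ibeta (a / 2) (t ^+ 2) - ibeta a t) @[t --> 0^'+] --> 0.
Proof.
move=> a0; rewrite -[X in _ --> X]subr0; apply: cvgB; last exact: ibeta_cvg0.
apply: cvg_comp_at_right (@cvg_sqr_at_right0 R) _ _.
  by near=> y; rewrite exprn_gt0.
by apply: ibeta_cvg0; rewrite divr_gt0.
Unshelve. all: by end_near. Qed.

(** The kernel is regular on the support of f. With s = 1 - X, the cut at y = 1 + s sends both parts
    onto ]0, 1[ with parameters 1 - m and m; [ibeta_cst_cosecant] sums them to pi / sin (pi m),
    which cancels the sine in f. *)
Lemma has_integral_lt1 (X : R) : X < 1 ->
  has_integral `]1, +oo[ (fun y => f y / (X - y)) (pi * (1 - X) `^ (- m)).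
Proof.
move=> X1; pose s := 1 - X; have s0 : 0 < s by rewrite subr_gt0.
have XE : X = 1 - s by rewrite /s; lra.
rewrite -/s; clearbody s; subst X.
have S0 := sin_pi_gt0 m01.
have Dw (t : R) : 0 < t < 1 ->
    derivable (fun t : R => (1 + t)^-1) t 1 /\ 0 <= (1 + t)^-1.
  move=> /andP[t0 _]; split; last by rewrite invr_ge0 addr_ge0 ?ltW.
  have tN1 : -1 < t by lra.
  by have ? := is_derive_1DV tN1; exact: ex_derive.
pose k a : R := ibeta_cst (a / 2) - ibeta_cst a - ln 2.
have I1 : has_integral `]1, 1 + s * 1[ (fun y => f y / (1 - s - y))
    (sin (pi * m) * (s `^ (- m) * k (1 - m))).
  have h := @has_integral_scale R (fun t => (1 + t)^-1) _ m s _ _ s0 ltr01 _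
    Dw (ibeta_alt_cvg0 m1) (ibeta_alt_cvg m1).
  apply: has_integral_eq (has_integralZl _ _ (h _)) => //.
  - move=> y; rewrite /= in_itv/= => /andP[y1 ys].
    rewrite f_gt1//; move: (sin _) (_ `^ _) => S P.
    by field; apply/and3P; split; [rewrite lt_eqF | rewrite gt_eqF | rewrite gt_eqF]; lra.
  - move=> t t01; have -> : t `^ (- m) = t `^ (1 - m - 1) by congr (_ `^ _); lra.
    exact: is_derive_ibeta_alt.
have I2 : has_integral `]1 + s / 1, +oo[ (fun y => f y / (1 - s - y))
    (sin (pi * m) * (s `^ (- m) * k m)).
  have h := @has_integral_scaleV R (fun t => (1 + t)^-1) _ m s _ _ s0 ltr01 _
    Dw (ibeta_alt_cvg0 m0) (ibeta_alt_cvg m0).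
  apply: has_integral_eq (has_integralZl _ _ (h _)) => //.
  - move=> y; rewrite /= in_itv/= andbT divr1 => ys.
    have y1 : 1 < y by lra.
    rewrite f_gt1//; move: (sin _) (_ `^ _) => S P.
    by field; apply/and3P; split; [rewrite lt_eqF | rewrite gt_eqF | rewrite gt_eqF]; lra.
  - by move=> t t01; exact: is_derive_ibeta_alt.
move: I1 I2; rewrite mulr1 divr1 => I1 I2.
(* The cut point lies in neither open piece and is added as a null set. *)
have I12 := has_integralU (measurable_itv _) (measurable_set1 (1 + s)) _ I1
  (has_integral_set1 (1 + s) _).
rewrite (_ : `]1, +oo[%classic = `]1, 1 + s[%classic `|` [set 1 + s] `|` `]1 + s, +oo[%classic).
  rewrite [X in has_integral _ _ X](_ : _ = sin (pi * m) * (s `^ (- m) * k (1 - m)) + 0 +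
      sin (pi * m) * (s `^ (- m) * k m)).
    apply: has_integralU I2 => //; first exact: measurableU.
      by apply/disj_setPS => y /= [[h1|h1] h2]; move: h1 h2; rewrite ?in_itv/= ?andbT; lra.
    by apply: I12; apply/disj_setPS => y /= [h1 h2]; move: h1 h2; rewrite ?in_itv/=; lra.
  have := ibeta_cst_cosecant m01; rewrite -/(k m) -/(k (1 - m)) => E.
  rewrite addr0 -!mulrDr [k (1 - m) + _]addrC E.
  by field; rewrite gt_eqF.
apply/seteqP; split => y /=; rewrite !in_itv/= ?andbT.
  by move=> y1; case: (ltgtP y (1 + s)) => h; [left; left|right|left; right]; rewrite ?y1.
by move=> [[/andP[]//|->]|]; lra.
Qed.

(** f vanishes on ]-oo, 1], so the domain matters only through ]1, +oo[. This serves both the whole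
    line and the truncated domains of small radius. *)
Lemma has_integral_trunc_lt1 (X : R) (D : set R) : X < 1 -> measurable D ->
  `]1, +oo[%classic `<=` D ->
  has_integral D (fun y => f y / (X - y)) (pi * (1 - X) `^ (- m)).
Proof.
move=> X1 mD D1.
rewrite (_ : D = `]1, +oo[%classic `|` (D `&` `]-oo, 1]%classic)).
  rewrite -[X in has_integral _ _ X]addr0.
  apply: has_integralU (has_integral_lt1 X1) _ => //; first exact: measurableI.
    by apply/disj_setPS => y /= [+ []]; rewrite !in_itv/= andbT => + _; lra.
  apply: has_integral0; first exact: measurableI.
  by move=> y /= []; rewrite in_itv/= => _ /f_le1 ->; rewrite mul0r.
apply/seteqP; split => y /=.
  by move=> Dy; rewrite !in_itv/= andbT; have [y1|y1] := leP y 1; [right|left].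
by move=> [/D1//|[]].
Qed.

Lemma is_hilbert_lt1 (X : R) : X < 1 -> is_hilbert f X (1 / (1 - X) `^ m).
Proof.
move=> X1; have s0 : 0 < 1 - X by rewrite subr_gt0.
split.
  move=> eps e0.
  apply: integrableS (has_integral_trunc_lt1 X1 (@measurableT _ _) _).1 => //.
  exact: truncation_set_measurable.
have -> : 1 / (1 - X) `^ m = pi^-1 * (pi * (1 - X) `^ (- m)).
  by rewrite powRN mulrA mulVf ?gt_eqF ?pi_gt0.
(* Once eps < 1 - X the excluded window misses ]1, +oo[, so the truncated transform is eventually
   constant. *)
apply: cvg_near_cst; near=> eps; have e0 : 0 < eps by [].
rewrite /hilbert_trunc (has_integral_trunc_lt1 X1 _ _).2//.
  exact: truncation_set_measurable.
have eX : eps < 1 - X by near: eps; exact: nbhs_right_lt.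
move=> y /=; rewrite in_itv/= andbT => y1.
by rewrite lter_normr; apply/orP; right; lra.
Unshelve. all: by end_near. Qed.

End hilbert_power.

Lemma has_integral_itv_cc (R : realType) (f : R -> R) (x y v : R) : x < y ->
  has_integral `]x, y[ f v -> has_integral `[x, y] f v.
Proof.
move=> xy H; rewrite (_ : `[x, y]%classic = `]x, y[%classic `|` [set x] `|` [set y]).
  rewrite -[v]addr0 -[v]addr0; apply: has_integralU (has_integral_set1 _ _) => //.
  - exact: measurableU.
  - by apply/disj_setPS => z /= [[h1|h1] h2]; move: h1 h2; rewrite ?in_itv/=; lra.
  apply: has_integralU (has_integral_set1 _ _) => //.
  by apply/disj_setPS => z /= [h1 h2]; move: h1 h2; rewrite ?in_itv/=; lra.
apply/seteqP; split => z /=; rewrite !in_itv/=.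
  move=> /andP[]; rewrite le_eqVlt => /orP[/eqP->|xz]; first by left; right.
  by rewrite le_eqVlt => /orP[/eqP->|yz]; [right | left; left; rewrite xz].
by move=> [[/andP[h1 h2]|->]|->]; rewrite ?lexx ?ltW.
Qed.

(** * The velocity and the profile equation *)

Section profile.
Context {R : realType}.
Variable (a : R).
Hypothesis a_lt0 : a < 0.
Notation m := ((1 - a)^-1).
Notation Omega := (Omega_bar a).

Let a1 : 0 < 1 - a. Proof. by move: a_lt0; lra. Qed.

Let m01 : 0 < m < 1.
Proof. by rewrite invr_gt0 a1 invf_lt1//; move: a_lt0; lra. Qed.

Let c0 : 0 < 1 - m. Proof. by rewrite subr_gt0; case/andP: m01. Qed.

Lemma Omega_bar_le1 y : y <= 1 -> Omega y = 0.
Proof. by rewrite /Omega_bar leNgt => /negbTE ->; rewrite mul0r mulr0. Qed.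

Lemma Omega_bar_gt1 y : 1 < y -> Omega y = - sin (pi * m) * (y - 1) `^ (- m).
Proof.
by move=> y1; rewrite /Omega_bar y1 div1r powRN distrC gtr0_norm// subr_gt0.
Qed.

Lemma is_hilbert_Omega_bar (X : R) : X != 1 ->
  is_hilbert Omega X
    (((if X < 1 then 1 else 0) + (if 1 < X then 1 else 0) * cos (pi * m))
      / (`|1 - X| `^ m)).
Proof.
case: ltgtP => // X1 _.
  rewrite mul0r addr0 gtr0_norm ?subr_gt0//.
  exact: (is_hilbert_lt1 m01 Omega_bar_le1 Omega_bar_gt1).
rewrite mul1r add0r distrC gtr0_norm ?subr_gt0//.
exact: (is_hilbert_gt1 m01 Omega_bar_le1 Omega_bar_gt1).
Qed.

Lemma hilbert_Omega_bar_lt1 (X : R) : X < 1 -> hilbert Omega X = (1 - X) `^ (- m).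
Proof.
move=> X1; rewrite powRN -div1r; apply: cvg_lim => //.
exact: (is_hilbert_lt1 m01 Omega_bar_le1 Omega_bar_gt1 X1).2.
Qed.

Lemma hilbert_Omega_bar_gt1 (X : R) : 1 < X ->
  hilbert Omega X = cos (pi * m) * (X - 1) `^ (- m).
Proof.
move=> X1; rewrite powRN; apply: cvg_lim => //.
exact: (is_hilbert_gt1 m01 Omega_bar_le1 Omega_bar_gt1 X1).2.
Qed.

Lemma is_derive_powR_1B p (y : R) : y < 1 ->
  is_derive y 1 (fun y => (1 - y) `^ p) (- (p * (1 - y) `^ (p - 1))).
Proof.
move=> y1; apply: is_derive_eq.
  apply: (@is_derive1_chain _ (fun x => x `^ p) (fun y => 1 - y) y _ _ _ (is_derive_1B y)).
  by apply: is_derive1_powR; rewrite subr_gt0.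
by rewrite mulrN1.
Qed.

(** At y = 1 the base tends to 0 and p > 0 gives the limit; for y < 1 differentiability does. The
    end case lets the integral of the transform reach its singularity. *)
Lemma powR_1B_cvg_left p (y : R) : 0 < p -> y <= 1 ->
  (1 - x) `^ p @[x --> y^'-] --> (1 - y) `^ p.
Proof.
move=> p0; rewrite le_eqVlt => /orP[/eqP->|y1]; last first.
  apply: cvg_at_left_filter; exact: is_derive1_continuous (is_derive_powR_1B p y1).
rewrite subrr powR0 ?gt_eqF//; apply: cvg_comp_at_right (powR_cvg0 p0).
  apply: cvg_at_left_filter; rewrite -[X in _ --> X](subrr 1).
  exact: is_derive1_continuous (is_derive_1B 1).
by near=> x; rewrite subr_gt0.
Unshelve. all: by end_near. Qed.

Lemma has_integral_hilbert_lt1 x y : x < y -> y <= 1 ->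
  has_integral `]x, y[ (hilbert Omega) (((1 - x) `^ (1 - m) - (1 - y) `^ (1 - m)) / (1 - m)).
Proof.
move=> xy y1.
have -> : ((1 - x) `^ (1 - m) - (1 - y) `^ (1 - m)) / (1 - m) =
    - (1 - m)^-1 * (1 - y) `^ (1 - m) - - (1 - m)^-1 * (1 - x) `^ (1 - m) by ring.
apply: (@has_integral_eq _ _ (fun y => (1 - y) `^ (- m))) => //.
  move=> z /=; rewrite in_itv/= => /andP[_ zy].
  by rewrite hilbert_Omega_bar_lt1// (lt_le_trans zy).
apply: (@ge0_FTC_oo _ _ (fun y => - (1 - m)^-1 * (1 - y) `^ (1 - m))) => //.
- move=> z /andP[_ zy]; have z1 := lt_le_trans zy y1; split.
  + apply: is_derive_eq (is_derive1Zl _ (is_derive_powR_1B _ z1)) _.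
    rewrite (_ : 1 - m - 1 = - m); last by ring.
    by rewrite mulrNN mulrA mulVf ?mul1r// gt_eqF.
  + exact: is_derive1_continuous (is_derive_powR_1B _ z1).
  + exact: powR_ge0.
- apply: cvgM; first exact: cvg_cst.
  apply: cvg_at_right_filter.
  exact: is_derive1_continuous (is_derive_powR_1B _ (lt_le_trans xy y1)).
- by apply: cvgM; [exact: cvg_cst | exact: powR_1B_cvg_left].
Qed.

Lemma has_integral_hilbert_gt1 y : 1 < y ->
  has_integral `]1, y[ (hilbert Omega) (cos (pi * m) * ((1 - m)^-1 * (y - 1) `^ (1 - m))).
Proof.
move=> y1.
apply: (@has_integral_eq _ _ (fun y => cos (pi * m) * (y - 1) `^ (- m))) => //.
  by move=> z /=; rewrite in_itv/= => /andP[z1 _]; rewrite hilbert_Omega_bar_gt1.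
apply: has_integralZl => //.
rewrite -[X in has_integral _ _ X]subr0 -[X in has_integral _ _ (_ - X)](mulr0 (1 - m)^-1).
apply: (@ge0_FTC_oo _ _ (fun y => (1 - m)^-1 * (y - 1) `^ (1 - m))) => //.
- move=> z /andP[z1 _]; split.
  + apply: is_derive_eq (is_derive1Zl _ (is_derive_powR_shift _ z1)) _.
    rewrite (_ : 1 - m - 1 = - m); last by ring.
    by rewrite mulrA mulVf ?mul1r// gt_eqF.
  + exact: is_derive1_continuous (is_derive_powR_shift _ z1).
  + exact: powR_ge0.
- apply: cvgM; first exact: cvg_cst.
  apply: cvg_comp_at_right (powR_cvg0 c0).
    apply: cvg_at_right_filter; rewrite -[X in _ --> X](subrr 1).
    exact: is_derive1_continuous (is_derive_subr1 1).
  by near=> x; rewrite subr_gt0.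
- apply: cvgM; first exact: cvg_cst.
  apply: cvg_at_left_filter; exact: is_derive1_continuous (is_derive_powR_shift _ y1).
Unshelve. all: by end_near. Qed.

Lemma U_bar_lt1 (X : R) : X < 1 -> U_bar a X = (1 - (1 - X) `^ (1 - m)) / (1 - m).
Proof.
move=> X1; rewrite /U_bar /oint; case: (ltgtP 0 X) => X0.
- rewrite (has_integral_itv_cc X0 (has_integral_hilbert_lt1 X0 (ltW X1))).2.
  by rewrite subr0 powR1.
- rewrite (has_integral_itv_cc X0 (has_integral_hilbert_lt1 X0 ler01)).2.
  by rewrite subr0 powR1 -mulNr opprB.
- by rewrite -X0 set_itv1 Rintegral_set1 subr0 powR1 subrr mul0r.
Qed.

(** The integral crosses the singularity at 1, which is isolated as a null set: whatever value
    [hilbert] takes there contributes nothing. *)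
Lemma U_bar_gt1 (X : R) : 1 < X ->
  U_bar a X = (1 + cos (pi * m) * (X - 1) `^ (1 - m)) / (1 - m).
Proof.
move=> X1; have X0 : 0 < X by lra.
have H := has_integralU (measurable_itv _) (measurable_set1 1) _
  (has_integral_hilbert_lt1 ltr01 (lexx 1)) (has_integral_set1 1 _).
rewrite /U_bar /oint (ltW X0).
have {}H : has_integral `]0, X[ (hilbert Omega)
    ((1 + cos (pi * m) * (X - 1) `^ (1 - m)) / (1 - m)).
  rewrite (_ : `]0, X[%classic = `]0, 1[%classic `|` [set 1] `|` `]1, X[%classic).
    rewrite [X in has_integral _ _ X](_ : _ = ((1 - 0) `^ (1 - m) - (1 - 1) `^ (1 - m))
      / (1 - m) + 0 + cos (pi * m) * ((1 - m)^-1 * (X - 1) `^ (1 - m))); last first.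
      by rewrite subr0 subrr powR0 ?gt_eqF// powR1; ring.
    apply: has_integralU (has_integral_hilbert_gt1 X1) => //; first exact: measurableU.
      by apply/disj_setPS => z /= [[h1|h1] h2]; move: h1 h2; rewrite ?in_itv/=; lra.
    by apply: H; apply/disj_setPS => z /= [h1 h2]; move: h1 h2; rewrite ?in_itv/=; lra.
  apply/seteqP; split => z /=; rewrite !in_itv/=.
    move=> /andP[z0 zX].
    by case: (ltgtP z 1) => z1; [left; left; rewrite z0 | right | left; right].
  by move=> [[/andP[h1 h2]|->]|/andP[h1 h2]]; lra.
by rewrite (has_integral_itv_cc X0 H).2.
Qed.

Lemma is_derive_Omega_bar_lt1 (X : R) : X < 1 -> is_derive X 1 Omega 0.
Proof.
move=> X1; apply: (@near_eq_is_derive _ _ _ (cst 0)) => //.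
near=> y; rewrite Omega_bar_le1// ltW//; near: y; exact: lt_nbhsl.
Unshelve. all: by end_near. Qed.

Lemma is_derive_Omega_bar_gt1 (X : R) : 1 < X ->
  is_derive X 1 Omega (- sin (pi * m) * (- m * (X - 1) `^ (- m - 1))).
Proof.
move=> X1.
apply: (@near_eq_is_derive _ _ _ (fun y : R => - sin (pi * m) * (y - 1) `^ (- m))).
  by near=> y; rewrite Omega_bar_gt1//; near: y; exact: lt_nbhsr.
exact: is_derive1Zl (is_derive_powR_shift _ X1).
Unshelve. all: by end_near. Qed.

(** The closed form of [U_bar] holds on a neighbourhood of X and is differentiated in place of the
    integral. *)
Lemma is_derive_U_bar_lt1 (X : R) : X < 1 -> is_derive X 1 (U_bar a) ((1 - X) `^ (- m)).
Proof.
move=> X1.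
apply: (@near_eq_is_derive _ _ _ (fun y : R => (1 - m)^-1 * (1 - (1 - y) `^ (1 - m)))).
  by near=> y; rewrite U_bar_lt1 1?mulrC//; near: y; exact: lt_nbhsl.
apply: is_derive_eq (is_derive1Zl _ (@is_derive1B _ (cst 1) _ _ _ _
  (is_derive_cst _ _ _) (is_derive_powR_1B _ X1))) _.
rewrite (_ : 1 - m - 1 = - m); last by ring.
by rewrite sub0r opprK mulrA mulVf ?mul1r// gt_eqF.
Unshelve. all: by end_near. Qed.

Lemma is_derive_U_bar_gt1 (X : R) : 1 < X ->
  is_derive X 1 (U_bar a) (cos (pi * m) * (X - 1) `^ (- m)).
Proof.
move=> X1.
apply: (@near_eq_is_derive _ _ _
  (fun y : R => (1 - m)^-1 * (1 + cos (pi * m) * (y - 1) `^ (1 - m)))).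
  by near=> y; rewrite U_bar_gt1 1?mulrC//; near: y; exact: lt_nbhsr.
apply: is_derive_eq (is_derive1Zl _ (@is_derive1D _ (cst 1) _ _ _ _
  (is_derive_cst _ _ _) (is_derive1Zl _ (is_derive_powR_shift _ X1)))) _.
rewrite (_ : 1 - m - 1 = - m); last by ring.
by rewrite add0r mulrCA; congr (_ * _); rewrite mulrA mulVf ?mul1r// gt_eqF.
Unshelve. all: by end_near. Qed.

(** Write C = cos (pi m) and P = (X-1)^(-m). Since 1 - m = - a/(1-a), the transport speed factors as
    (1-a)(X-1)(1 - C P), while the derivative of Omega is - m Omega / (X-1). With m (1-a) = 1 the
    left side is (-1 + C P) Omega. *)
Lemma profile_equation_gt1 (X : R) : 1 < X ->
  ((1 - a) * X + a * U_bar a X) * derive1 Omega X =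
  (-1 + derive1 (U_bar a) X) * Omega X.
Proof.
move=> X1.
rewrite (is_derive1_derive1 (is_derive_Omega_bar_gt1 X1)).
rewrite (is_derive1_derive1 (is_derive_U_bar_gt1 X1)).
rewrite U_bar_gt1// Omega_bar_gt1//.
have X0 : 0 < X - 1 by rewrite subr_gt0.
have -> : (X - 1) `^ (1 - m) = (X - 1) * (X - 1) `^ (- m).
  by rewrite powRD ?(gt_eqF X0) ?implybT// powRr1// ltW.
have -> : (X - 1) `^ (- m - 1) = (X - 1) `^ (- m) / (X - 1).
  by rewrite powRB ?(gt_eqF X0) ?implybT// powRr1// ltW.
have -> : 1 - m = - a / (1 - a) by field; rewrite gt_eqF.
move: (cos _) (sin _) (_ `^ _) => C S P.
by field; rewrite ?oppr_eq0 ?(lt_eqF a_lt0) ?(gt_eqF a1) ?(gt_eqF X0).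
Qed.

End profile.

Unset Implicit Arguments.
Set Strict Implicit.

Theorem mainTheorem4 (R : realType) (a : R) (ha : a < 0) :
  let mu := (1 - a)^-1 in
  let cl := 1 - a in
  let cw := -1 : R in
  (forall X : R, X != 1 ->
     is_hilbert (Omega_bar a) X
       (((if X < 1 then 1 else 0) + (if 1 < X then 1 else 0) * cos (pi * mu))
          / (`|1 - X| `^ mu))) /\
  (forall X : R, X != 1 ->
     derivable (Omega_bar a) X 1 /\ derivable (U_bar a) X 1 /\
     (cl * X + a * U_bar a X) * derive1 (Omega_bar a) X
       = (cw + derive1 (U_bar a) X) * Omega_bar a X).
Proof.
split=> X; first exact: is_hilbert_Omega_bar.
case: ltgtP => // X1 _.
- have ? := is_derive_Omega_bar_lt1 a X1.
  have ? := is_derive_U_bar_lt1 ha X1.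
  split; [exact: ex_derive | split; first exact: ex_derive].
  (* To the left of 1 the profile and its derivative are 0, so both sides vanish. *)
  by rewrite Omega_bar_le1 ?(ltW X1)// is_derive1_derive1 !mulr0.
- have ? := is_derive_Omega_bar_gt1 a X1.
  have ? := is_derive_U_bar_gt1 ha X1.
  split; [exact: ex_derive | split; first exact: ex_derive].
  exact: profile_equation_gt1.
Qed.
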